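(* Let $(S,T)$ be a pair of semistandard shifted Young tableaux such that $T$ extends $S$, and let the modified shifted tableau switching send $(S,T)$ to $(\widetilde{{}^ST},\widetilde{S_T})$. Then: (a) $\widetilde{S_T}\cup\widetilde{{}^ST}$ has the same shape as $S\cup T$; moreover $\widetilde{S_T}$ has the same weight as $S$ and $\widetilde{{}^ST}$ has the same weight as $T$; (b) $\widetilde{S_T}$ extends $\widetilde{{}^ST}$, and $\widetilde{S_T}$ and $\widetilde{{}^ST}$ are semistandard shifted Young tableaux.
   Context: Shifted shapes: for a strict partition $\lambda$, $S(\lambda)=\{(i,j):1\le i\le\ell(\lambda),\ i\le j\le\lambda_i+i-1\}$ (matrix coordinates), main diagonal $\{(i,i)\}$, $\lambda/\mu=S(\lambda)\setminus S(\mu)$; $\lambda/\mu$ extends $\mu/\nu$ when $\nu\subseteq\mu\subseteq\lambda$; a filling extends another if its shape does. Letters $X=\{1'<1<2'<2<\cdots\}$; bold $\mathbf k$ means $k$ or $k'$. A shifted Young tableau (SYT): filling of a skew shifted shape by $X$, weakly increasing along rows and columns, each column with at most one unprimed $k$, each row with at most one $k'$; semistandard (SSYT) if no primed entry is on the main diagonal. Weight $\mathrm{wt}(T)=(\mathrm{wt}_1,\mathrm{wt}_2,\ldots)$, $\mathrm{wt}_i$ = number of entries $i$ or $i'$; $\max(T)$ the largest $i$ with $\mathrm{wt}_i>0$. Switches on fillings with boxes labelled $\mathbf a$-boxes (entries $a,a'$) or $\mathbf b$-boxes (entries $b,b'$), at an $\mathbf a$-box $c=(i,j)$ with entry $\alpha$,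 $E=(i,j+1)$, $S'=(i+1,j)$ (entries move with labels): (S3) $j=i$, $E$ a $\mathbf b$-box with entry $b'$, $(i+1,i+1)$ a $\mathbf b$-box with entry $\beta$: new entries $\beta$ at $(i,i)$, $b$ at $(i,i+1)$ ($\mathbf b$-boxes), $\alpha$ at $(i+1,i+1)$. (S4) $j=i+1$, $\alpha=a$, $(i,i)$ an $\mathbf a$-box with entry $\alpha_0$, $S'=(i+1,i+1)$ a $\mathbf b$-box with entry $\beta$, $E$ not a $\mathbf b$-box: new entries $\beta$ at $(i,i)$, $a'$ at $(i,i+1)$, $\alpha_0$ at $(i+1,i+1)$. (S7) as (S4) but $E$ a $\mathbf b$-box with entry $b$ (unchanged). (S5) $E,S'$ both $\mathbf b$-boxes, $E$ entry $b'$: interchange $c,E$. (S6) $E,S'$ both $\mathbf b$-boxes, $E$ entry $b$, not (S7): interchange $c,S'$. (S1) only $E$ a $\mathbf b$-box, not (S3): interchange $c,E$. (S2) only $S'$ a $\mathbf b$-box, not (S4): interchange $c,S'$. Modified switches: (S1$'$) $c=(i,i)$ with entry $a$, $E$ the only $\mathbf b$-neighbor with entry $b'$, not case (S3): new entries $b$ at $(i,i)$, $a'$ at $(i,i+1)$. (S2$'$) $c$ has entry $a'$, $S'=(i+1,i+1)$ on the main diagonal with entry $b$ is the only $\mathbf b$-neighbor: new entries $b'$ at $c$, $a$ at $S'$. (S6$'$) $c$ has entry $a'$, $E$ has entry $b$, $S'=(i+1,i+1)$ on the main diagonal has entry $b$: new entries $b'$ at $c$, $b$ at $E$, $a$ at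 $S'$. Fully switched: no $\mathbf a$-box has a $\mathbf b$-box as east or south neighbor. $\Box(U)$: easternmost $\mathbf a$-box with entry $a$ having a $\mathbf b$-box as east or south neighbor, or if none, the southernmost such with entry $a'$. Modified shifted switching process on a pair ($\mathbf a$-part, $\mathbf b$-part): apply at $\Box(U)$ the applicable switch (a modified one in the configurations of (S1$'$), (S2$'$), (S6$'$), otherwise one of (S1)–(S7)) until fully switched. Modified shifted tableau switching of $(S,T)$, $T$ extending $S$: label boxes by $S$ or $T$; with $m=\max(S)$, $n=\max(T)$, for $i=m,\ldots,1$ and for each $i$, $j=1,\ldots,n$, apply in the current filling the modified shifted switching process to (current $S$-boxes with entries $\mathbf i$, current $T$-boxes with entries $\mathbf j$). $\widetilde{S_T}$ is the final filling of the $S$-labelled boxes and $\widetilde{{}^ST}$ that of the $T$-labelled boxes; components are treated independently. *)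

(* Defs.v *)
From mathcomp Require Import all_boot.
From mathcomp Require Import finmap zify.

Set Implicit Arguments.
Unset Strict Implicit.
Unset Printing Implicit Defensive.

Local Open Scope fset_scope.
Local Open Scope fmap_scope.
Local Open Scope nat_scope.

(* A box [(i, j)] has row [i] and column [j], both counted from 1. *)
Definition box := (nat * nat)%type.

Definition strict_partition (lam : seq nat) : bool :=
  sorted gtn lam && (0 \notin lam).

Definition part (lam : seq nat) (i : nat) : nat := nth 0 lam i.-1.

Definition included (mu lam : seq nat) : Prop :=
  forall i, 1 <= i -> part mu i <= part lam i.

Definition shifted_diagram (lam : seq nat) : pred box :=
  [pred c | 1 <= c.1 <= size lam & c.1 <= c.2 <= part lam c.1 + c.1 - 1].

(* The letter [(k, true)] is k' and [(k, false)] is k. *)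
Definition letter := (nat * bool)%type.
Definition num (x : letter) : nat := x.1.
Definition primed (x : letter) : bool := x.2.

Definition letter_le (x y : letter) : bool :=
  (num x < num y) || ((num x == num y) && (primed y ==> primed x)).

Definition filling := {fmap box -> letter}.

Definition has_shape (lam mu : seq nat) (F : filling) : Prop :=
  [/\ strict_partition lam, strict_partition mu, included mu lam
    & domf F =i [pred c | shifted_diagram lam c & ~~ shifted_diagram mu c]].

Definition SYT (F : filling) : Prop :=
  (exists lam mu, has_shape lam mu F) /\
  [/\ forall c : domf F, 0 < num (F c),
      forall c d : domf F, (val c).1 = (val d).1 -> (val c).2 <= (val d).2 ->
        letter_le (F c) (F d),
      forall c d : domf F, (val c).2 = (val d).2 -> (val c).1 <= (val d).1 ->
        letter_le (F c) (F d),
      forall c d : domf F, (val c).2 = (val d).2 -> F c = F d ->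
        ~~ primed (F c) -> c = d
    & forall c d : domf F, (val c).1 = (val d).1 -> F c = F d ->
        primed (F c) -> c = d].

Definition SSYT (F : filling) : Prop :=
  SYT F /\ forall c : domf F, (val c).1 = (val c).2 -> ~~ primed (F c).

(* G extends F, as fillings of lam/mu and mu/nu.  The three partitions are
   explicit because a set of boxes can be a skew shape in several ways. *)
Definition extends (lam mu nu : seq nat) (G F : filling) : Prop :=
  has_shape lam mu G /\ has_shape mu nu F.

Definition wt (F : filling) (k : nat) : nat :=
  #|[pred c : domf F | num (F c) == k]|.

(* For the empty filling this is 0. *)
Definition max_letter (F : filling) : nat := \max_(c : domf F) num (F c).

(* The current filling of S and T together: [inl x] is an entry x of an
   S-labelled box, [inr x] an entry x of a T-labelled box. *)
Definition pair_filling := {fmap box -> letter + letter}.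

Section Process.

Variables a b : nat.

(* [a_entry U c] is [Some p] if c is a bold-a-box, with p telling whether its
   entry is primed; likewise [b_entry].  All other boxes, including S-boxes and
   T-boxes with other entries, yield [None] for both. *)
Definition a_entry (U : pair_filling) (c : box) : option bool :=
  if U.[? c] is Some (inl x) then
    if num x == a then Some (primed x) else None
  else None.

Definition b_entry (U : pair_filling) (c : box) : option bool :=
  if U.[? c] is Some (inr x) then
    if num x == b then Some (primed x) else None
  else None.

Definition a_put (U : pair_filling) (c : box) (p : bool) : pair_filling :=
  U.[c <- inl (a, p)].
Definition b_put (U : pair_filling) (c : box) (p : bool) : pair_filling :=
  U.[c <- inr (b, p)].

Definition east (c : box) : box := (c.1, c.2.+1).
Definition south (c : box) : box := (c.1.+1, c.2).

(* The local names are those of the switching rules; S5 and S1 move the entries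
   in the same way, and so do S6 and S2, and S7 and S4.  In S3 and S1' the box
   (i, i) has no south neighbour, since (i+1, i) is not in a shifted diagram. *)
Definition switch (U : pair_filling) (c : box) : pair_filling :=
  let: (i, j) := c in
  let E := east c in
  let S' := south c in
  let S1 p q := a_put (b_put U c q) E p in
  let S2 p q := a_put (b_put U c q) S' p in
  let S1' := a_put (b_put U c false) E true in
  let S2' := a_put (b_put U c true) S' false in
  let S3 p q := a_put (b_put (b_put U c q) E false) (i.+1, i.+1) p in
  let S4 p0 q :=
    a_put (a_put (b_put U (i, i) q) c true) S' p0 in
  let S5 := S1 in
  let S6 := S2 in
  let S6' := a_put (b_put (b_put U c true) E false) S' false in
  let S7 := S4 in
  match a_entry U c, b_entry U E, b_entry U S' with
  | Some p, Some q, None =>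
      if (j == i) && q then
        if b_entry U (i.+1, i.+1) is Some r then S3 p r
        else if p then S1 p q else S1'
      else S1 p q
  | Some p, None, Some r =>
      if j == i.+1 then
        if p then (if r then S2 p r else S2')
        else if a_entry U (i, i) is Some p0 then S4 p0 r else S2 p r
      else S2 p r
  | Some p, Some q, Some r =>
      if q then S5 p q
      else if j == i.+1 then
        if p then (if r then S6 p r else S6')
        else if a_entry U (i, i) is Some p0 then S7 p0 r else S6 p r
      else S6 p r
  | _, _, _ => U
  end.

Definition active (p : bool) (U : pair_filling) (c : box) : bool :=
  (a_entry U c == Some p) && (b_entry U (east c) || b_entry U (south c)).

Definition fully_switched (U : pair_filling) : bool :=
  [forall c : domf U, ~~ active false U (val c) && ~~ active true U (val c)].

Definition is_Box (U : pair_filling) (c : box) : bool :=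
  if [exists d : domf U, active false U (val d)] then
    active false U c &&
    [forall d : domf U, active false U (val d) ==> ((val d).2 <= c.2)]
  else
    active true U c &&
    [forall d : domf U, active true U (val d) ==> ((val d).1 <= c.1)].

(* For the fillings that arise from tableaux at most one box satisfies [is_Box],
   so the choice made by [pick] is immaterial.  Working on a disconnected
   filling at once amounts to treating its connected components independently:
   a switch reads and writes within the component of its box only, and the
   order in which the boxes [is_Box] of the whole filling occur restricts on
   each component to the order prescribed there. *)
Definition step (U : pair_filling) : pair_filling :=
  if [pick c : domf U | is_Box U (val c)] is Some c then switch U (val c)
  else U.

(* Termination: each switch moves bold-a-boxes south or east, so it increases
   the potential [pot], which is bounded by the sum over all boxes. *)

Let w (c : box) : nat := c.1 + c.2.
Let pot (U : pair_filling) : nat :=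
  \sum_(c <- domf U | a_entry U c : bool) w c.

Lemma a_entry_set (U : pair_filling) x v c :
  a_entry U.[x <- v] c =
  if c == x then
    (if v is inl y then if num y == a then Some (primed y) else None else None)
  else a_entry U c.
Proof. by rewrite /a_entry fnd_set; case: eqP. Qed.

Lemma a_entry_dom (U : pair_filling) c : a_entry U c -> c \in domf U.
Proof. by rewrite /a_entry; case: fndP. Qed.

Lemma b_entry_dom (U : pair_filling) c : b_entry U c -> c \in domf U.
Proof. by rewrite /b_entry; case: fndP. Qed.

Lemma ab_entry (U : pair_filling) c : b_entry U c -> a_entry U c = None.
Proof. by rewrite /b_entry /a_entry; case: fndP => // xU; case: (U.[xU]). Qed.

Lemma domf_set_in (U : pair_filling) x v :
  x \in domf U -> domf U.[x <- v] = domf U.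
Proof. by move=> xU; rewrite dom_setf; apply/fsetUidPr; rewrite fsub1set. Qed.

Lemma pot_set (U : pair_filling) x v : x \in domf U ->
  pot U.[x <- v] + (a_entry U x : bool) * w x =
  pot U + (a_entry U.[x <- v] x : bool) * w x.
Proof.
move=> xU; rewrite /pot domf_set_in // 2![in LHS]big_mkcond /= 2![in RHS]big_mkcond /=.
rewrite !(bigD1_seq x) ?fset_uniq //=.
have -> : \sum_(i <- domf U | i != x) (if a_entry U.[x <- v] i then w i else 0)
  = \sum_(i <- domf U | i != x) (if a_entry U i then w i else 0).
  by apply: eq_bigr => i /negbTE ix; rewrite a_entry_set ix.
by case: (a_entry U x) => [?|]; case: (a_entry U.[x <- v] x) => [?|] /=; lia.
Qed.

Lemma pot_a U x p : x \in domf U ->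
  pot (a_put U x p) + (a_entry U x : bool) * w x = pot U + w x.
Proof.
by move=> xU; rewrite pot_set // a_entry_set /num /= !eqxx mul1n.
Qed.

Lemma pot_b U x q : x \in domf U ->
  pot (b_put U x q) + (a_entry U x : bool) * w x = pot U.
Proof. by move=> xU; rewrite pot_set // a_entry_set eqxx mul0n addn0. Qed.

Lemma domf_a U x p : x \in domf U -> domf (a_put U x p) = domf U.
Proof. exact: domf_set_in. Qed.

Lemma domf_b U x q : x \in domf U -> domf (b_put U x q) = domf U.
Proof. exact: domf_set_in. Qed.

Lemma a_entry_b U x q c :
  a_entry (b_put U x q) c = if c == x then None else a_entry U c.
Proof. by rewrite a_entry_set. Qed.

Lemma a_entry_a U x p c :
  a_entry (a_put U x p) c = if c == x then Some p else a_entry U c.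
Proof. by rewrite a_entry_set /num /= eqxx. Qed.

Lemma swap_pot U x y p q :
  a_entry U x -> b_entry U y -> w x < w y ->
  domf (a_put (b_put U x q) y p) = domf U /\
  pot U < pot (a_put (b_put U x q) y p).
Proof.
move=> ax b_y wxy; have [xU yU] := (a_entry_dom ax, b_entry_dom b_y).
have ay := ab_entry b_y.
have yU' : y \in domf (b_put U x q) by rewrite domf_b.
split; first by rewrite domf_a ?domf_b.
have := pot_a p yU'; have := pot_b q xU.
by rewrite a_entry_b ay ax if_same mul1n mul0n; lia.
Qed.

Lemma shift_pot U x y z p q r :
  a_entry U x -> b_entry U y -> b_entry U z -> y != z -> w x < w z ->
  domf (a_put (b_put (b_put U x q) y r) z p) = domf U /\
  pot U < pot (a_put (b_put (b_put U x q) y r) z p).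
Proof.
move=> ax b_y bz yz wxz.
have [xU yU zU] := And3 (a_entry_dom ax) (b_entry_dom b_y) (b_entry_dom bz).
have [ay az] := (ab_entry b_y, ab_entry bz).
have yU' : y \in domf (b_put U x q) by rewrite domf_b.
have zU' : z \in domf (b_put (b_put U x q) y r) by rewrite !domf_b.
split; first by rewrite domf_a ?domf_b.
have := pot_a p zU'; have := pot_b r yU'; have := pot_b q xU.
by rewrite !a_entry_b ax ay az !if_same mul1n !mul0n; lia.
Qed.

Lemma rotate_pot U x y z p q r :
  a_entry U x -> a_entry U y -> b_entry U z -> x != y -> w x < w z ->
  domf (a_put (a_put (b_put U x q) y r) z p) = domf U /\
  pot U < pot (a_put (a_put (b_put U x q) y r) z p).
Proof.
move=> ax ay bz xy wxz.
have [xU yU zU] := And3 (a_entry_dom ax) (a_entry_dom ay) (b_entry_dom bz).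
have az := ab_entry bz.
have yU' : y \in domf (b_put U x q) by rewrite domf_b.
have zU' : z \in domf (a_put (b_put U x q) y r) by rewrite domf_a ?domf_b.
have zy : (z == y) = false by apply/eqP => zy; rewrite zy in az; rewrite az in ay.
split; first by rewrite domf_a ?domf_a ?domf_b.
have := pot_a p zU'; have := pot_a r yU'; have := pot_b q xU.
rewrite a_entry_a !a_entry_b ax az zy if_same eq_sym (negbTE xy) ay !mul1n mul0n; lia.
Qed.

Lemma switch_pot p U c : active p U c ->
  domf (switch U c) = domf U /\ pot U < pot (switch U c).
Proof.
rewrite /active => /andP[/eqP ap].
case: c ap => i j ap; rewrite /switch.
set E := east _; set S' := south _.
have wE : w (i, j) < w E by rewrite /w /=; lia.
have wS : w (i, j) < w S' by rewrite /w /=; lia.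
have ax : a_entry U (i, j) by rewrite ap.
have ES : E != S' by apply/eqP => -[]; lia.
rewrite ap; case bE: (b_entry U E) => [q|]; case bS: (b_entry U S') => [r|] //= _.
- have [bE' bS'] : b_entry U E /\ b_entry U S' by rewrite bE bS.
  case: ifP => _; first exact: swap_pot.
  case: eqP => [ji|_]; last exact: swap_pot.
  case: p ap => ap; first by case: r bS => bS; [exact: swap_pot|exact: shift_pot].
  case ai: (a_entry U (i, i)) => [p0|]; last exact: swap_pot.
  by apply: rotate_pot; rewrite ?ai //; [apply/eqP => -[]|rewrite /w /=]; lia.
- have bE' : b_entry U E by rewrite bE.
  case: ifP => [/andP[/eqP ji _]|_]; last exact: swap_pot.
  case bd: (b_entry U _) => [r|].
    by apply: shift_pot; rewrite ?bd //; [apply/eqP => -[]|rewrite /w /=]; lia.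
  by case: p {ap} => //; exact: swap_pot.
- have bS' : b_entry U S' by rewrite bS.
  case: eqP => [ji|_]; last exact: swap_pot.
  case: p ap => ap; first by case: r bS => bS; exact: swap_pot.
  case ai: (a_entry U (i, i)) => [p0|]; last exact: swap_pot.
  by apply: rotate_pot; rewrite ?ai //; [apply/eqP => -[]|rewrite /w /=]; lia.
Qed.

Lemma is_Box_exists U : ~~ fully_switched U ->
  exists c : domf U, is_Box U (val c).
Proof.
rewrite /fully_switched negb_forall => /existsP[c0 nc0].
have [/existsP[d act_d]|no_act] :=
    boolP [exists d : domf U, active false U (val d)].
  case: (@arg_maxnP _ d (fun e => active false U (val e))
          (fun e => (val e).2) act_d) => c act_c max_c.
  exists c; rewrite /is_Box ifT ?act_c; last by apply/existsP; exists c.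
  by apply/forallP => e; apply/implyP; apply: max_c.
have act_c0 : active true U (val c0).
  by move: no_act nc0; rewrite negb_exists => /forallP ->; rewrite negbK.
case: (@arg_maxnP _ c0 (fun e => active true U (val e))
        (fun e => (val e).1) act_c0) => c act_c max_c.
exists c; rewrite /is_Box (negbTE no_act) act_c.
by apply/forallP => e; apply/implyP; apply: max_c.
Qed.

Lemma step_pot U : ~~ fully_switched U ->
  domf (step U) = domf U /\ pot U < pot (step U).
Proof.
move=> /is_Box_exists[c Uc]; rewrite /step.
case: pickP => [d|/(_ c)]; last by rewrite Uc.
by rewrite /is_Box; case: ifP => _ /andP[+ _]; apply: switch_pot.
Qed.

Lemma process_stops U : exists k, fully_switched (iter k step U).
Proof.
have [n] := ubnP ((\sum_(c <- domf U) w c).+1 - pot U).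
elim: n U => // n IHn U leUn.
have [fsU|nfsU] := boolP (fully_switched U); first by exists 0.
have [domU potU] := step_pot nfsU.
have le_pot : pot U <= \sum_(c <- domf U) w c.
  rewrite /pot [leqLHS]big_mkcond /=.
  by apply: leq_sum => c _; case: ifP.
have [|k fsk] := IHn (step U); first by rewrite domU; lia.
by exists k.+1; rewrite iterSr.
Qed.

Definition process (U : pair_filling) : pair_filling :=
  iter (ex_minn (process_stops U)) step U.

End Process.

Definition label (S T : filling) : pair_filling :=
  ([fmap c : domf S => inl (S c)] + [fmap c : domf T => inr (T c)])%fset.

Definition S_part (U : pair_filling) : filling :=
  reducef [fmap c : domf U => if U c is inl x then Some x else None].

Definition T_part (U : pair_filling) : filling :=
  reducef [fmap c : domf U => if U c is inr x then Some x else None].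

Definition switching_order (m n : nat) : seq (nat * nat) :=
  [seq (i, j) | i <- rev (iota 1 m), j <- iota 1 n].

(* The first component is the final filling of the T-labelled boxes, the second
   one that of the S-labelled boxes. *)
Definition modified_switching (S T : filling) : filling * filling :=
  let U :=
    foldl (fun U ij => process ij.1 ij.2 U) (label S T)
      (switching_order (max_letter S) (max_letter T)) in
  (T_part U, S_part U).

(* Main.v *)
(* The tableau S u T is a filling whose entries weakly increase from north-west
   to south-east for the order S_1 < ... < S_m < T_1 < ... < T_n of its letters,
   and the process on the letters (a, b) exchanges two letters that are adjacent
   in the current order.  After all exchanges the letters of T precede those of
   S, so the T-boxes together with S(nu) form an order ideal, i.e. a shifted
   diagram.

   It remains to see why a single process gives a filling of the right kind.
   Order the a-boxes by putting the boxes a' first, from north to south, then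
   the boxes a, from west to east; the process always moves the last a-box that
   can move.  The intermediate fillings satisfy an invariant, [perforated]: the
   tableau inequalities hold within each letter, each letter has at most one box
   on the diagonal, and if one a-box precedes another one, then the first has no
   b-box to its north-west or the second no b-box to its south-east, which says
   that the earlier box has not started moving or the later one has finished.
   For a box strictly south-east of another one with the same entry, the entry
   of their north-east corner is prescribed ([pf_corner0], [pf_corner1]); this
   is what keeps a moving box from overtaking the ones moved before it.  All the
   switches preserve the invariant, and when no a-box has a b-box to its east or
   south, convexity shows that no a-box is north-west of a b-box. *)
Require Import Defs.
From mathcomp Require Import all_boot.
From mathcomp Require Import finmap zify.

Set Implicit Arguments.
Unset Strict Implicit.
Unset Printing Implicit Defensive.

(** * Perforated fillings *)

(* [inl p] is a bold-a-box and [inr p] a bold-b-box, with [p] telling whether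
   the entry is primed; all other boxes are [None]. *)
Definition cell := option (bool + bool).
Definition cells := nat -> nat -> cell.

(** The tableau conditions for a single letter: primed entries come first and never share a row,
    unprimed ones never share a column. They are imposed on all pairs in north-west to south-east
    position, because the corner between two such boxes may carry the other letter. *)
Definition ordered (p q : bool) (i j k l : nat) : bool :=
  [&& i <= k, j <= l & (i < k) || (j < l)] ==>
  (q ==> (p && (i < k))) && (~~ p ==> (~~ q && (j < l))).

(* The order in which the bold-a-boxes leave their initial position, reversed. *)
Definition before (p : bool) (i j : nat) (q : bool) (k l : nat) : bool :=
  [|| p && ~~ q, [&& p, q & i < k] | [&& ~~ p, ~~ q & j < l]].

(** Midway through a process neither letter need form a skew shape, so convexity is asked of their
    union. The corner fields concern a-boxes; the analogue for b-boxes depends on the moving box and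
    is [corner_b]. *)
Record perforated (s : cells) : Prop := Perforated {
  pf_shifted : forall i j v, s i j = Some v -> i <= j;
  pf_convex : forall i j k l x y, s i j -> s k l ->
    i <= x <= k -> j <= y <= l -> x <= y -> s x y;
  pf_a : forall i j k l p q, s i j = Some (inl p) -> s k l = Some (inl q) ->
    ordered p q i j k l;
  pf_b : forall i j k l p q, s i j = Some (inr p) -> s k l = Some (inr q) ->
    ordered p q i j k l;
  pf_diag_a : forall i p, s i i = Some (inl p) -> p = false;
  pf_diag_b : forall i p, s i i = Some (inr p) -> p = false;
  pf_uniq_a : forall i k p q, s i i = Some (inl p) -> s k k = Some (inl q) -> i = k;
  pf_uniq_b : forall i k p q, s i i = Some (inr p) -> s k k = Some (inr q) -> i = k;
  pf_corner0 : forall i j k l, s i j = Some (inl false) -> s k l = Some (inl false) ->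
    i < k -> j < l -> k = i.+1 /\ s i l = Some (inr false);
  pf_corner1 : forall i j k l, s i j = Some (inl true) -> s k l = Some (inl true) ->
    i < k -> j < l -> l = j.+1 /\ s i l = Some (inr true);
  pf_moved : forall i j p k l q m n r m' n' r',
    s i j = Some (inl p) -> s k l = Some (inl q) ->
    s m n = Some (inr r) -> s m' n' = Some (inr r') ->
    ~~ [&& before p i j q k l, m <= i, n <= j, k <= m' & l <= n']
}.

(* What the choice of [(i, j)] as the box to be moved says about the others:
   those before it have not been moved, those after it have come to rest. *)
Record mobile (s : cells) (i j : nat) (p : bool) : Prop := Mobile {
  mb_at : s i j = Some (inl p);
  mb_before : forall k l q m n r, s k l = Some (inl q) -> s m n = Some (inr r) ->
    ~~ [&& before q k l p i j, m <= k & n <= l];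
  mb_after : forall k l q m n r, s k l = Some (inl q) -> s m n = Some (inr r) ->
    ~~ [&& before p i j q k l, k <= m & l <= n]
}.

Definition upd (s : cells) (i j : nat) (v : bool + bool) : cells :=
  fun k l => if (k == i) && (l == j) then Some v else s k l.

Lemma perforated_ext s t : (forall i j, s i j = t i j) -> perforated s -> perforated t.
Proof.
move=> st [H1 H2 H3 H4 H5 H6 H7 H8 H9 H10 H11].
by split; intros *; rewrite -?st; eauto.
Qed.

(** * Positions relative to the moving box *)

Section Mobile.
Variables (s : cells) (i j : nat) (p : bool).
Hypotheses (pf : perforated s) (mb : mobile s i j p).

(** The numerical content of two a-boxes in one boolean, so that contradictions between positions
    and primes are left to [lia]; [bb_facts] and [ab_facts] serve the other pairs of letters. *)
Lemma aa_facts k l q m n r : s k l = Some (inl q) -> s m n = Some (inl r) ->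
  [&& k <= l, m <= n, ordered q r k l m n, ordered r q m n k l,
      (k == m) && (l == n) ==> (q == r), (k == l) ==> ~~ q
    & [&& k == l & m == n] ==> (k == m)].
Proof.
move=> e f; rewrite (pf_shifted pf e) (pf_shifted pf f) (pf_a pf e f) (pf_a pf f e) /=.
apply/and3P; split; apply/implyP.
- by case/andP=> /eqP ek /eqP el; move: e f; rewrite ek el => -> [->].
- by move=> /eqP kl; move: e; rewrite kl => /(pf_diag_a pf) ->.
- by case/andP=> /eqP kl /eqP mn; subst; rewrite (pf_uniq_a pf e f).
Qed.

Lemma bb_facts k l q m n r : s k l = Some (inr q) -> s m n = Some (inr r) ->
  [&& k <= l, m <= n, ordered q r k l m n, ordered r q m n k l,
      (k == m) && (l == n) ==> (q == r), (k == l) ==> ~~ q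
    & [&& k == l & m == n] ==> (k == m)].
Proof.
move=> e f; rewrite (pf_shifted pf e) (pf_shifted pf f) (pf_b pf e f) (pf_b pf f e) /=.
apply/and3P; split; apply/implyP.
- by case/andP=> /eqP ek /eqP el; move: e f; rewrite ek el => -> [->].
- by move=> /eqP kl; move: e; rewrite kl => /(pf_diag_b pf) ->.
- by case/andP=> /eqP kl /eqP mn; subst; rewrite (pf_uniq_b pf e f).
Qed.

Lemma ab_facts k l q m n r : s k l = Some (inl q) -> s m n = Some (inr r) ->
  [&& k <= l, m <= n, ~~ [&& before q k l p i j, m <= k & n <= l],
      ~~ [&& before p i j q k l, k <= m & l <= n]
    & ~~ ((k == m) && (l == n))].
Proof.
move=> e f; rewrite (pf_shifted pf e) (pf_shifted pf f) (mb_before mb e f) (mb_after mb e f) /=.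
by apply/negP => /andP[/eqP ek /eqP el]; move: e f; rewrite ek el => ->.
Qed.

(* Together with the moving box, the bold-b-boxes form a skew shape. *)
Lemma between_bb k l m n x y q r : s k l = Some (inr q) -> s m n = Some (inr r) ->
  k <= x <= m -> l <= y <= n -> x <= y -> ~~ ((x == i) && (y == j)) ->
  exists r', s x y = Some (inr r').
Proof.
move=> e f kxm lyn xy ne; have cm := mb_at mb.
have: s x y by apply: (pf_convex pf (i := k) (j := l) (k := m) (l := n)); rewrite ?e ?f.
case g: (s x y) => [[q'|r']|//] _; last by exists r'.
(* An a-box in between, other than the moving one, comes before or after it, so it has no b-box to
   its north-west or none to its south-east. *)
exfalso; move: (aa_facts cm g) (ab_facts g e) (ab_facts g f); rewrite /ordered /before; lia.
Qed.

Lemma between_cb m n x y r : s m n = Some (inr r) ->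
  i <= x <= m -> j <= y <= n -> x <= y -> ~~ ((x == i) && (y == j)) ->
  exists r', s x y = Some (inr r').
Proof.
move=> f kxm lyn xy ne; have cm := mb_at mb.
have: s x y by apply: (pf_convex pf (i := i) (j := j) (k := m) (l := n)); rewrite ?cm ?f.
case g: (s x y) => [[q'|r']|//] _; last by exists r'.
(* An a-box south-east of the moving one comes after it and is at rest, so no b-box lies to its
   south-east. *)
exfalso; move: (aa_facts cm g) (ab_facts g f); rewrite /ordered /before; lia.
Qed.

(* A strip of a single letter contains no 2 x 2 square. *)
Lemma corner_b k l m n q r : s k l = Some (inr q) -> s m n = Some (inr r) ->
  k < m -> l < n -> k = i /\ n = j.
Proof.
move=> e f km ln.
have kl := pf_shifted pf e.
case: (boolP ((k == i) && (n == j))) => [/andP[/eqP-> /eqP->] //|ne].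
(* The north-east corner would be a b-box: primed, it clashes with its row; unprimed, with its
   column. *)
have [|||r' g] := between_bb (x := k) (y := n) e f _ _ _ ne; try lia.
by exfalso; move: (bb_facts e g) (bb_facts g f) (bb_facts e f); rewrite /ordered; lia.
Qed.


(** Serves [pf_moved] after switches whose new b-boxes lie weakly south-east of [(i, j)]: no a-box
    preceding the moving one has such a box to its north-west. *)
Lemma unmoved k l q x y : s k l = Some (inl q) -> before q k l p i j ->
  (exists r, s x y = Some (inr r)) \/ (i <= x /\ j <= y) -> x <= k -> y <= l -> False.
Proof.
move=> e kc [[r f]|[ix jy]] xk yl; first by move: (mb_before mb e f); lia.
by move: (aa_facts (mb_at mb) e) kc; rewrite /ordered /before; lia.
Qed.

(** An a-box with a b-box to its south-east is not at rest. The position [(x, y)] is only bounded by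
    an old b-box further south-east, so that it may also be a b-box created by a switch. *)
Lemma unfinished k l q x y : s k l = Some (inl q) ->
  (exists x' y' r, [/\ s x' y' = Some (inr r), x <= x' & y <= y']) ->
  k <= x -> l <= y -> ~~ ((k == i) && (l == j)) -> before q k l p i j.
Proof.
move=> e [x' [y' [r [f xx' yy']]]] xk yl ne.
by move: (mb_after mb e f) (aa_facts (mb_at mb) e) ne; rewrite /ordered /before; lia.
Qed.

End Mobile.

Lemma upd_dom (t : cells) m n v k l : t m n -> isSome (upd t m n v k l) = isSome (t k l).
Proof. by rewrite /upd; case: ifP => // /andP[/eqP-> /eqP->] ->. Qed.

Ltac fin := rewrite /ordered /before /=; lia.

Ltac upd_split :=
  rewrite /upd;
  repeat (case: ifP => [/andP[/eqP ? /eqP ?]|/negbT ?]; subst).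

(** * The switches preserve perforated fillings *)

Section East.
Variables (s : cells) (i j : nat) (p : bool).
Hypotheses (pf : perforated s) (mb : mobile s i j p).

(* (S1) and (S5) *)
Lemma perforated_east q : s i j.+1 = Some (inr q) ->
  (forall r, s i.+1 j = Some (inr r) -> q) -> (i = j -> q = false) ->
  perforated (upd (upd s i j (inr q)) i j.+1 (inl p)).
Proof.
move=> e hS hd; have cm := mb_at mb.
have ij := pf_shifted pf cm.
have dV k l : isSome (upd (upd s i j (inr q)) i j.+1 (inl p) k l) = isSome (s k l).
  by rewrite !upd_dom ?cm // e.
split.
- move=> k l v; upd_split; try lia; exact: (pf_shifted pf).
- by move=> k l m n x y; rewrite !dV; apply: (pf_convex pf).
- move=> k l m n q1 q2; upd_split=> // h1 h2.
  + by case: h1 h2 => <- [<-]; fin.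
  (* The danger is an unprimed a-box below the new position of an unprimed one. Then [pf_corner0]
     makes the east entry unprimed, while the box at [(i.+1, j)] cannot be an a-box and, as a b-box,
     would contradict [hS]. *)
  + case: h1 => <-; have [sp|nsp] := boolP [&& ~~ p, ~~ q2, i < m & n == j.+1]; last first.
      by move: (aa_facts pf cm h2) (ab_facts pf mb h2 e); fin.
    case/and4P: sp => /negbTE p0 /negbTE q20 im /eqP nj; subst n.
    move: cm h2; rewrite p0 q20 => cm0 h2.
    have [//|mi e0] := pf_corner0 pf cm0 h2 im.
    move: e0; rewrite e => -[q0]; subst m.
    have [ji|ji] := eqVneq i j; first by subst j; move: (aa_facts pf cm0 h2); fin.
    have: s i.+1 j by apply: (pf_convex pf (i := i) (j := j) (k := i.+1) (l := j.+1)); rewrite ?cm0 ?h2 //; lia.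
    case g: (s i.+1 j) => [[q'|r]|//] _; last by move: (hS _ g); rewrite q0.
    by move: (aa_facts pf cm0 g) (aa_facts pf h2 g); fin.
  + case: h2 => <-; move: (aa_facts pf cm h1) (ab_facts pf mb h1 e); fin.
  + exact: (pf_a pf h1 h2).
- move=> k l m n q1 q2; upd_split=> // h1 h2.
  + by case: h1 h2 => <- [<-]; fin.
  (* A b-box further down column [j] forces one at the south neighbour, so [hS] makes the moved
     b-entry primed. *)
  + case: h1 => <-; have [sp|nsp] := boolP [&& i < m & n == j]; last first.
      by move: (bb_facts pf e h2) (ab_facts pf mb cm h2); fin.
    case/andP: sp => im /eqP nj; subst n.
    have [||||r g] := between_cb pf mb (x := i.+1) (y := j) h2; try lia.
      by move: (pf_shifted pf h2); lia.
    have qt := hS _ g.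
    by move: (bb_facts pf e h2) (ab_facts pf mb cm h2); fin.
  + case: h2 => <-; have [sp|nsp] := boolP [&& k < i & l == j]; last first.
      by move: (bb_facts pf e h1) (ab_facts pf mb cm h1); fin.
    case/andP: sp => ki /eqP lj; subst l.
    by have [||] := corner_b pf mb h1 e; lia.
  + exact: (pf_b pf h1 h2).
- move=> k q1; upd_split=> //; [lia|exact: (pf_diag_a pf)].
- move=> k q1; upd_split=> //; [by case=> <-; apply: hd|exact: (pf_diag_b pf)].
- move=> k l q1 q2; upd_split=> //; try lia; exact: (pf_uniq_a pf).
- have buniq k r : s k k = Some (inr r) -> i = j -> i = k.
    move=> h ji; subst j.
    have [ki|ik|//] := ltngtP k i.
      by have [||] := corner_b pf mb h e; lia.
    have [||||r' g] := between_cb pf mb (x := i.+1) (y := i.+1) h; try lia.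
    have := hd erefl; move=> q0.
    by move: (bb_facts pf e g); fin.
  move=> k l q1 q2; upd_split=> // h1 h2; try lia.
  + by rewrite (buniq _ _ h2).
  + by rewrite (buniq _ _ h1).
  + exact: (pf_uniq_b pf h1 h2).
- move=> k l m n h1 h2 km ln.
  set w := upd _ _ _ _ k n; move: h1 h2; upd_split=> // h1 h2; try lia; rewrite {}/w.
  + move: h1 => [p0]; move: cm; rewrite p0 => cm0.
    have [||mi e0] := pf_corner0 pf cm0 h2; try lia.
    by split=> //; upd_split=> //; lia.
  + move: h2 => [p0]; move: cm; rewrite p0 => cm0.
    have [lj|jl] := ltnP l j; last by move: (aa_facts pf cm0 h1); fin.
    have [||mi e0] := pf_corner0 pf h1 cm0; try lia.
    by have [||] := corner_b pf mb e0 e; lia.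
  + have [mk e0] := pf_corner0 pf h1 h2 km ln.
    split=> //; upd_split=> //; last by move: cm; rewrite e0.
    (* The corner would be the b-box that moves away, and it is unprimed; the box south of [(i, j)]
       is then in the filling, but can be neither an a-box nor, by [hS], a b-box. *)
    exfalso.
    move: e0; rewrite e => -[q0].
    have: s i.+1 j by apply: (pf_convex pf (i := i) (j := j) (k := i.+1) (l := j.+1)); rewrite ?cm ?h2 //; move: (pf_shifted pf h1); lia.
    case g: (s i.+1 j) => [[q'|r]|//] _; last by move: (hS _ g); rewrite q0.
    by move: (aa_facts pf cm h1) (aa_facts pf cm g) (aa_facts pf h2 g) (aa_facts pf cm h2) ; fin.
- move=> k l m n h1 h2 km ln.
  set w := upd _ _ _ _ k n; move: h1 h2; upd_split=> // h1 h2; try lia; rewrite {}/w.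
  + move: h1 => [p1]; move: cm; rewrite p1 => cm1.
    by have [||] := pf_corner1 pf cm1 h2; lia.
  + move: h2 => [p1]; move: cm; rewrite p1 => cm1.
    have [lj|jl] := ltnP l j.
      have [||jl e1] := pf_corner1 pf h1 cm1; try lia.
      by have [||] := corner_b pf mb e1 e; lia.
    (* A new corner arises: a primed a-box above the old position is now strictly north-west of the
       moved one. The entry at the corner is primed because it stands above the old b-box in column
       [j.+1]. *)
    have lj : l = j by lia.
    subst l; split=> //.
    upd_split=> //; try lia.
    have: s k j.+1 by apply: (pf_convex pf (i := k) (j := j) (k := i) (l := j.+1)); rewrite ?e ?h1 //; lia.
    case g: (s k j.+1) => [[q'|r]|//] _.
      by move: (aa_facts pf h1 g) (ab_facts pf mb g e); fin.
    by case: r g => // g; move: (bb_facts pf g e); fin.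
  + have [mk e0] := pf_corner1 pf h1 h2 km ln.
    split=> //; upd_split=> //; last by move: cm; rewrite e0.
    lia.
- move=> k l p1 m n q1 x y r x' y' r' h1 h2 h3 h4; apply/negP => /and5P[bef xk yl mx' ny'].
  (* [up] replaces the south-eastern b-box by an old one at least as far south-east; [dn] says that
     the north-western one is old or lies weakly south-east of the vacated box. *)
  have up : exists u v t, [/\ s u v = Some (inr t), x' <= u & y' <= v].
    move: h4; upd_split=> // h4; last by exists x', y', r'.
    by exists i, j.+1, q; split=> //; lia.
  have dn : (exists t, s x y = Some (inr t)) \/ (i <= x /\ j <= y).
    by move: h3; upd_split=> // h3; [right|left; exists r].
  move: h1 h2; upd_split=> // h1 h2.
  + by move: h1 h2 bef => [<-] [<-]; fin.
  + have kc := unfinished pf mb h2 up mx' ny' ltac:(done).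
    by move: h1 kc bef (aa_facts pf cm h2) => [<-]; fin.
  + apply: (unmoved pf mb h1 _ dn xk yl).
    by move: h2 bef (aa_facts pf cm h1) => [<-]; fin.
  + have kc := unfinished pf mb h2 up mx' ny' ltac:(done).
    apply: (unmoved pf mb h1 _ dn xk yl).
    by move: bef kc; fin.
Qed.

End East.

Section South.
Variables (s : cells) (i j : nat) (p : bool).
Hypotheses (pf : perforated s) (mb : mobile s i j p).

(* (S2) and (S6) *)
Lemma perforated_south r : s i.+1 j = Some (inr r) ->
  (forall q, s i j.+1 = Some (inr q) -> q = false) ->
  (j = i.+1 -> p = false /\ forall q, s i i <> Some (inl q)) ->
  perforated (upd (upd s i j (inr r)) i.+1 j (inl p)).
Proof.
move=> e hE hd; have cm := mb_at mb.
have ij := pf_shifted pf e.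
have dV k l : isSome (upd (upd s i j (inr r)) i.+1 j (inl p) k l) = isSome (s k l).
  by rewrite !upd_dom ?cm // e.
split.
- move=> k l v; upd_split; try lia; exact: (pf_shifted pf).
- by move=> k l m n x y; rewrite !dV; apply: (pf_convex pf).
- move=> k l m n q1 q2; upd_split=> // h1 h2.
  + by case: h1 h2 => <- [<-]; fin.
  (* Two primed a-boxes in row [i.+1] would come from a pair as in [pf_corner1], whose corner is a
     primed east neighbour, against [hE]. *)
  + case: h1 => <-; have [sp|nsp] := boolP [&& p, q2, m == i.+1 & j < n]; last first.
      by move: (aa_facts pf cm h2) (ab_facts pf mb h2 e); fin.
    case/and4P: sp => p1 q21 /eqP mi jn.
    move: cm h2; rewrite p1 q21 => cm1 h2.
    have [||nj e1] := pf_corner1 pf cm1 h2; try lia.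
    by subst n; move: (hE _ e1).
  + case: h2 => <-; move: (aa_facts pf cm h1) (ab_facts pf mb h1 e); fin.
  + exact: (pf_a pf h1 h2).
- move=> k l m n q1 q2; upd_split=> // h1 h2.
  + by case: h1 h2 => <- [<-]; fin.
  + case: h1 => <-; have [sp|nsp] := boolP [&& m == i & j < n]; last first.
      by move: (bb_facts pf e h2) (ab_facts pf mb cm h2); fin.
    case/andP: sp => /eqP im jn; subst m.
    have [||||q g] := between_cb pf mb (x := i) (y := j.+1) h2; try lia.
    have qt := hE _ g.
    by move: (bb_facts pf e h2) (bb_facts pf g h2) (ab_facts pf mb cm h2); fin.
  + case: h2 => <-; have [sp|nsp] := boolP [&& k == i, l < j, r & q1]; last first.
      by move: (bb_facts pf e h1) (ab_facts pf mb cm h1); fin.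
    case/and4P: sp => /eqP ki lj r1 q11; subst k.
    have il := pf_shifted pf h1.
    have [li|li] := eqVneq l i; first by subst l; rewrite (pf_diag_b pf h1) in q11.
    have [||||q g] := between_bb pf mb (x := i.+1) (y := l) h1 e; try lia.
    by move: (bb_facts pf g e); fin.
  + exact: (pf_b pf h1 h2).
- move=> k q1; upd_split=> //; last exact: (pf_diag_a pf).
  by have [<- _] := hd erefl; case.
- move=> k q1; upd_split=> //; [lia|exact: (pf_diag_b pf)].
- have auniq k q : s k k = Some (inl q) -> j = i.+1 -> i.+1 = k.
    move=> h ji; subst j.
    have [p0 hi] := hd erefl.
    have [ki|ik|//] := ltngtP k i.+1.
      have [kj|kj] := eqVneq k i; first by subst k; case: (hi _ h).
      have: s i i by apply: (pf_convex pf (i := k) (j := k) (k := i) (l := i.+1)); rewrite ?cm ?h //; lia.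
      case g: (s i i) => [[q'|t]|//] _; first by case: (hi _ g).
      by move: (bb_facts pf g e); fin.
    have q0 := pf_diag_a pf h.
    move: cm h; rewrite p0 q0 => cm0 h.
    by have [||] := pf_corner0 pf cm0 h; lia.
  move=> k l q1 q2; upd_split=> // h1 h2; try lia.
  + by rewrite (auniq _ _ h2).
  + by rewrite (auniq _ _ h1).
  + exact: (pf_uniq_a pf h1 h2).
- move=> k l q1 q2; upd_split=> //; try lia; exact: (pf_uniq_b pf).
- move=> k l m n h1 h2 km ln.
  set w := upd _ _ _ _ k n; move: h1 h2; upd_split=> // h1 h2; try lia; rewrite {}/w.
  + move: h1 => [p0]; move: cm; rewrite p0 => cm0.
    have [||mi e0] := pf_corner0 pf cm0 h2; lia.
  + move: h2 => [p0]; move: cm; rewrite p0 => cm0.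
    have [ki|ki] := ltnP k i.
      have [||mi e0] := pf_corner0 pf h1 cm0; try lia.
      by move: (bb_facts pf e0 e); fin.
    (* A new corner arises with the unprimed a-boxes further west in row [i], so the entry left at
       [(i, j)] must be unprimed. The box below [(i, l)] shows it; if [l = i] there is none, and
       [(i.+1, i.+1)] takes its place. *)
    have ki' : k = i by lia.
    subst k; split=> //; upd_split; try lia.
    clear dV; case: r e => // e; exfalso.
    have il := pf_shifted pf h1.
    have [li|li] := eqVneq l i.
      subst l; have [ji|ji] := eqVneq j i.+1.
        by have [_ /(_ _ h1)] := hd ji.
      have: s i.+1 i.+1 by apply: (pf_convex pf (i := i) (j := i) (k := i.+1) (l := j)); rewrite ?e ?h1 //; lia.
      case g: (s i.+1 i.+1) => [[q'|t]|//] _.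
        by move: (aa_facts pf g h1); fin.
      by move: (bb_facts pf g e); fin.
    have: s i.+1 l by apply: (pf_convex pf (i := i) (j := l) (k := i.+1) (l := j)); rewrite ?e ?h1 //; lia.
    case g: (s i.+1 l) => [[q'|t]|//] _.
      by move: (aa_facts pf g h1); fin.
    by move: (bb_facts pf g e); fin.
  + have [mk e0] := pf_corner0 pf h1 h2 km ln.
    split=> //; upd_split=> //; last by move: cm; rewrite e0.
    exfalso.
    by move: (aa_facts pf cm h1) (aa_facts pf cm h2) (ab_facts pf mb h1 e) (ab_facts pf mb h2 e); fin.
- move=> k l m n h1 h2 km ln.
  set w := upd _ _ _ _ k n; move: h1 h2; upd_split=> // h1 h2; try lia; rewrite {}/w.
  + move: h1 => [p1]; move: cm; rewrite p1 => cm1.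
    have [||nj e1] := pf_corner1 pf cm1 h2; try lia.
    by subst n; move: (hE _ e1).
  + move: h2 => [p1]; move: cm; rewrite p1 => cm1.
    have [ki|ki] := ltnP k i; last by move: (aa_facts pf cm1 h1); fin.
    have [||jl e1] := pf_corner1 pf h1 cm1; try lia.
    by split=> //; upd_split=> //; lia.
  + have [mk e0] := pf_corner1 pf h1 h2 km ln.
    split=> //; upd_split=> //; last by move: cm; rewrite e0.
    exfalso.
    by move: (aa_facts pf cm h1) (aa_facts pf cm h2) (ab_facts pf mb h1 e) (ab_facts pf mb h2 e); fin.
- move=> k l p1 m n q1 x y t x' y' t' h1 h2 h3 h4; apply/negP => /and5P[bef xk yl mx' ny'].
  have up : exists u v t, [/\ s u v = Some (inr t), x' <= u & y' <= v].
    move: h4; upd_split=> // h4; last by exists x', y', t'.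
    by exists i.+1, j, r; split=> //; lia.
  have dn : (exists t, s x y = Some (inr t)) \/ (i <= x /\ j <= y).
    by move: h3; upd_split=> // h3; [right|left; exists t].
  move: h1 h2; upd_split=> // h1 h2.
  + by move: h1 h2 bef => [<-] [<-]; fin.
  + have kc := unfinished pf mb h2 up mx' ny' ltac:(done).
    by move: h1 kc bef (aa_facts pf cm h2) => [<-]; fin.
  + apply: (unmoved pf mb h1 _ dn xk yl).
    by move: h2 bef (aa_facts pf cm h1) => [<-]; fin.
  + have kc := unfinished pf mb h2 up mx' ny' ltac:(done).
    apply: (unmoved pf mb h1 _ dn xk yl).
    by move: bef kc; fin.
Qed.

End South.

(* (S1') *)
Lemma perforated_east' s i : perforated s -> mobile s i i false ->
  s i i.+1 = Some (inr true) -> (forall r, s i.+1 i.+1 <> Some (inr r)) ->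
  perforated (upd (upd s i i (inr false)) i i.+1 (inl true)).
Proof.
move=> pf mb e hT; have cm := mb_at mb.
set V := upd _ _ _ _.
have dV k l : isSome (V k l) = isSome (s k l).
  by rewrite !upd_dom ?cm // e.
(* The moving box becomes primed, so unprimed a-boxes further west must be excluded. They would put
   [(i.-1, i.-1)] in the filling, as a second diagonal a-box or as a b-box strictly north-west of
   the east neighbour. *)
have no0 k l : s k l = Some (inl false) -> l < i -> False.
  move=> h li; have kl := pf_shifted pf h.
  have: s i.-1 i.-1 by apply: (pf_convex pf (i := k) (j := l) (k := i) (l := i)); rewrite ?cm ?h //; lia.
  case g: (s i.-1 i.-1) => [[q'|t]|//] _.
    by move: (pf_uniq_a pf g cm); lia.
  by have [||] := corner_b pf mb g e; lia.
have lower k l r : s k l = Some (inr r) -> i < k -> i < l -> False.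
  move=> h ik il; have kl := pf_shifted pf h.
  by have [||||r' /hT//] := between_cb pf mb (x := i.+1) (y := i.+1) h; lia.
split.
- move=> k l v; rewrite /V; upd_split; try lia; exact: (pf_shifted pf).
- by move=> k l m n x y; rewrite !dV; apply: (pf_convex pf).
- move=> k l m n q1 q2; rewrite /V; upd_split=> // h1 h2.
  + by case: h1 h2 => <- [<-]; fin.
  + by case: h1 => <-; move: (aa_facts pf cm h2) (ab_facts pf mb h2 e); fin.
  + case: h2 => <-; case: q1 h1 => h1.
      by move: (aa_facts pf cm h1) (ab_facts pf mb h1 e); fin.
    by move: (no0 _ _ h1) (aa_facts pf cm h1) (ab_facts pf mb h1 e); fin.
  + exact: (pf_a pf h1 h2).
- move=> k l m n q1 q2; rewrite /V; upd_split=> // h1 h2.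
  + by case: h1 h2 => <- [<-]; fin.
  + by case: h1 => <-; move: (lower _ _ _ h2) (bb_facts pf e h2) (ab_facts pf mb cm h2); fin.
  + by case: h2 => <-; move: (bb_facts pf e h1) (ab_facts pf mb cm h1); fin.
  + exact: (pf_b pf h1 h2).
- move=> k q1; rewrite /V; upd_split=> //; [lia|exact: (pf_diag_a pf)].
- move=> k q1; rewrite /V; upd_split=> //; [by case|exact: (pf_diag_b pf)].
- move=> k l q1 q2; rewrite /V; upd_split=> //; try lia; exact: (pf_uniq_a pf).
- have buniq k r : s k k = Some (inr r) -> i = k.
    move=> h; have [ki|ik|//] := ltngtP k i; last by case: (lower _ _ _ h).
    by have [||] := corner_b pf mb h e; lia.
  move=> k l q1 q2; rewrite /V; upd_split=> // h1 h2; try lia.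
  + by rewrite (buniq _ _ h2).
  + by rewrite (buniq _ _ h1).
  + exact: (pf_uniq_b pf h1 h2).
- move=> k l m n h1 h2 km ln.
  set w := V k n; move: h1 h2; rewrite {1 2}/V; upd_split=> // h1 h2; try lia; rewrite {}/w.
  have [mk e0] := pf_corner0 pf h1 h2 km ln.
  by split=> //; rewrite /V; upd_split=> //; move: e0; rewrite e.
- move=> k l m n h1 h2 km ln.
  set w := V k n; move: h1 h2; rewrite {1 2}/V; upd_split=> // h1 h2; try lia; rewrite {}/w.
  + by move: (aa_facts pf cm h2); fin.
  (* A primed a-box north-west of the new primed one must lie in column [i], with [b'] at the
     corner; convexity and the old entries at [(i, i)] and [(i, i.+1)] give both. *)
  + have kl := pf_shifted pf h1.
    have: s k i.+1 by apply: (pf_convex pf (i := k) (j := l) (k := i) (l := i.+1)); rewrite ?e ?h1 //; lia.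
    case g: (s k i.+1) => [[q'|r]|//] _.
      by move: (aa_facts pf h1 g) (ab_facts pf mb g e); fin.
    have r1 : r = true by move: (bb_facts pf g e); fin.
    rewrite r1 in g.
    have li : l = i.
      have: s k i by apply: (pf_convex pf (i := k) (j := l) (k := i) (l := i)); rewrite ?cm ?h1 //; lia.
      case f: (s k i) => [[q'|t]|//] _.
        by move: (aa_facts pf h1 f) (aa_facts pf f cm); fin.
      by move: (bb_facts pf f g); fin.
    by split; [lia|rewrite /V; upd_split=> //; lia].
  + have [mk e0] := pf_corner1 pf h1 h2 km ln.
    split=> //; rewrite /V; upd_split=> //; last by move: cm; rewrite e0.
    lia.
- move=> k l p1 m n q1 x y r x' y' r' h1 h2 h3 h4; apply/negP => /and5P[bef xk yl mx' ny'].
  have up : exists u v t, [/\ s u v = Some (inr t), x' <= u & y' <= v].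
    move: h4; rewrite /V; upd_split=> // h4; last by exists x', y', r'.
    by exists i, i.+1, true; split=> //; lia.
  have dn : (exists t, s x y = Some (inr t)) \/ (i <= x /\ i <= y).
    by move: h3; rewrite /V; upd_split=> // h3; [right|left; exists r].
  move: h1 h2; rewrite /V; upd_split=> // h1 h2.
  + by move: h1 h2 bef => [<-] [<-]; fin.
  + have kc := unfinished pf mb h2 up mx' ny' ltac:(done).
    case: q1 h2 kc bef => h2 kc bef; last by move: (no0 _ _ h2) kc; fin.
    by move: h1 kc bef (aa_facts pf cm h2) => [<-]; fin.
  + apply: (unmoved pf mb h1 _ dn xk yl).
    by move: h2 bef (aa_facts pf cm h1) => [<-]; fin.
  + have kc := unfinished pf mb h2 up mx' ny' ltac:(done).
    apply: (unmoved pf mb h1 _ dn xk yl).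
    by move: bef kc; fin.
Qed.

(* (S2') and (S6') *)
Lemma perforated_south' s i : perforated s -> mobile s i i.+1 true ->
  s i.+1 i.+1 = Some (inr false) ->
  (forall q, s i i.+2 = Some (inr q) -> q = false) ->
  perforated (upd (upd s i i.+1 (inr true)) i.+1 i.+1 (inl false)).
Proof.
move=> pf mb e hE; have cm := mb_at mb.
set V := upd _ _ _ _.
have dV k l : isSome (V k l) = isSome (s k l).
  by rewrite !upd_dom ?cm // e.
(* The box [(i, i)] carries neither letter: an a-box there would be unprimed and west of [a'], a
   b-box would be the second one on the diagonal. *)
have nolow k l v : s k l = Some v -> k <= i -> l <= i -> False.
  move=> h ki li; have kl := pf_shifted pf h.
  have: s i i by apply: (pf_convex pf (i := k) (j := l) (k := i) (l := i.+1)); rewrite ?cm ?h //; lia.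
  case g: (s i i) => [[q'|t]|//] _.
    by move: (aa_facts pf g cm); fin.
  by move: (bb_facts pf g e); fin.
(* The moved entry becomes unprimed: [nolow1] and [upper] exclude unprimed a-boxes north-west and
   strictly south-east of its new position. *)
have nolow1 k l : s k l = Some (inl false) -> k <= i.+1 -> l <= i.+1 -> False.
  move=> h ki li; have kl := pf_shifted pf h.
  have [/andP[k1 l1]|kl1] := boolP [&& k <= i & l <= i]; first exact: (nolow _ _ _ h).
  by move: (aa_facts pf cm h) (ab_facts pf mb h e); fin.
have upper k l : s k l = Some (inl false) -> i.+1 < k -> i.+1 < l -> False.
  move=> h ik il; have kl := pf_shifted pf h.
  have: s i l by apply: (pf_convex pf (i := i) (j := i.+1) (k := k) (l := l)); rewrite ?cm ?h //; lia.
  case f: (s i l) => [[q'|t]|//] _.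
    by move: (aa_facts pf cm f) (aa_facts pf f h); fin.
  have [||||t' g] := between_cb pf mb (x := i) (y := i.+2) f; try lia.
  have t'0 := hE _ g; subst t'.
  have: s i.+1 l by apply: (pf_convex pf (i := i) (j := i.+1) (k := k) (l := l)); rewrite ?cm ?h //; lia.
  case d: (s i.+1 l) => [[q'|t']|//] _; last first.
    by move: (bb_facts pf g f) (bb_facts pf f d); fin.
  case: q' d => d; last by move: (aa_facts pf h d); fin.
  have [||ll e1] := pf_corner1 pf cm d; try lia.
  by subst l; move: g; rewrite e1.
have notup k l : s k l = Some (inl true) -> i < k -> i.+1 < l -> False.
  move=> h ik il; have [||ll e1] := pf_corner1 pf cm h; try lia.
  by subst l; move: (hE _ e1).
split.
- move=> k l v; rewrite /V; upd_split; try lia; exact: (pf_shifted pf).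
- by move=> k l m n x y; rewrite !dV; apply: (pf_convex pf).
- move=> k l m n q1 q2; rewrite /V; upd_split=> // h1 h2.
  + by case: h1 h2 => <- [<-]; fin.
  + case: h1 => <-; case: q2 h2 => h2.
      by move: (notup _ _ h2) (aa_facts pf cm h2) (ab_facts pf mb h2 e); fin.
    by move: (aa_facts pf cm h2) (ab_facts pf mb h2 e); fin.
  + case: h2 => <-; case: q1 h1 => h1; first by fin.
    by move: (nolow1 _ _ h1); fin.
  + exact: (pf_a pf h1 h2).
- move=> k l m n q1 q2; rewrite /V; upd_split=> // h1 h2.
  + by case: h1 h2 => <- [<-]; fin.
  + case: h1 => <-; have [/andP[/eqP mi jn]|nsp] := boolP [&& m == i & i.+1 < n]; last first.
      by move: (bb_facts pf e h2) (ab_facts pf mb cm h2); fin.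
    subst m.
    have [||||q g] := between_cb pf mb (x := i) (y := i.+2) h2; try lia.
    have qt := hE _ g.
    by move: (bb_facts pf g h2); fin.
  + case: h2 => <-.
    by move: (nolow _ _ _ h1) (bb_facts pf h1 e) (ab_facts pf mb cm h1); fin.
  + exact: (pf_b pf h1 h2).
- move=> k q1; rewrite /V; upd_split=> //; [by case|exact: (pf_diag_a pf)].
- move=> k q1; rewrite /V; upd_split=> //; [lia|exact: (pf_diag_b pf)].
- have auniq k q : s k k = Some (inl q) -> i.+1 = k.
    move=> h; have q0 := pf_diag_a pf h; subst q.
    have [ki|ik|//] := ltngtP k i.+1; first by case: (nolow _ _ _ h); lia.
    by case: (upper _ _ h).
  move=> k l q1 q2; rewrite /V; upd_split=> // h1 h2; try lia.
  + by rewrite (auniq _ _ h2).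
  + by rewrite (auniq _ _ h1).
  + exact: (pf_uniq_a pf h1 h2).
- move=> k l q1 q2; rewrite /V; upd_split=> //; try lia; exact: (pf_uniq_b pf).
- move=> k l m n h1 h2 km ln.
  set w := V k n; move: h1 h2; rewrite {1 2}/V; upd_split=> // h1 h2; try lia; rewrite {}/w.
  + by case: (upper _ _ h2).
  + by case: (nolow1 _ _ h1); lia.
  + have [mk e0] := pf_corner0 pf h1 h2 km ln.
    split=> //; rewrite /V; upd_split=> //; last by move: cm; rewrite e0.
    by move: (pf_shifted pf h1); lia.
- move=> k l m n h1 h2 km ln.
  set w := V k n; move: h1 h2; rewrite {1 2}/V; upd_split=> // h1 h2; try lia; rewrite {}/w.
  have [mk e0] := pf_corner1 pf h1 h2 km ln.
  by split=> //; rewrite /V; upd_split=> //; move: (pf_shifted pf h1); lia.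
- move=> k l p1 m n q1 x y r x' y' r' h1 h2 h3 h4; apply/negP => /and5P[bef xk yl mx' ny'].
  have up : exists u v t, [/\ s u v = Some (inr t), x' <= u & y' <= v].
    move: h4; rewrite /V; upd_split=> // h4; last by exists x', y', r'.
    by exists i.+1, i.+1, false; split=> //; lia.
  have dn : (exists t, s x y = Some (inr t)) \/ (i <= x /\ i.+1 <= y).
    by move: h3; rewrite /V; upd_split=> // h3; [right|left; exists r].
  move: h1 h2; rewrite /V; upd_split=> // h1 h2.
  + by move: h1 h2 bef => [<-] [<-]; fin.
  + have kc := unfinished pf mb h2 up mx' ny' ltac:(done).
    by move: h1 kc bef (aa_facts pf cm h2) => [<-]; fin.
  + have [bc|nbc] := boolP (before p1 k l true i i.+1).
      exact: (unmoved pf mb h1 bc dn xk yl).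
    case: h2 bef nbc => <-; case: p1 h1 => h1.
      by move: (notup _ _ h1) (aa_facts pf cm h1) (pf_shifted pf h1); fin.
    by move: (nolow1 _ _ h1) (pf_shifted pf h1); fin.
  + have kc := unfinished pf mb h2 up mx' ny' ltac:(done).
    apply: (unmoved pf mb h1 _ dn xk yl).
    by move: bef kc; fin.
Qed.

(* (S3) *)
Lemma perforated_shift s i : perforated s -> mobile s i i false ->
  s i i.+1 = Some (inr true) -> s i.+1 i.+1 = Some (inr false) ->
  perforated (upd (upd (upd s i i (inr false)) i i.+1 (inr false)) i.+1 i.+1 (inl false)).
Proof.
move=> pf mb e eT; have cm := mb_at mb.
set V := upd _ _ _ _.
have dV k l : isSome (V k l) = isSome (s k l).
  by rewrite !upd_dom ?cm // ?e ?eT.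
(* Both letters already have a diagonal box, at [(i, i)] and [(i.+1, i.+1)], so [(i.-1, i.-1)] can
   carry neither. *)
have no0 k l : s k l = Some (inl false) -> l < i -> False.
  move=> h li; have kl := pf_shifted pf h.
  have: s i.-1 i.-1 by apply: (pf_convex pf (i := k) (j := l) (k := i) (l := i)); rewrite ?cm ?h //; lia.
  case g: (s i.-1 i.-1) => [[q'|t]|//] _.
    by move: (pf_uniq_a pf g cm); lia.
  by move: (pf_uniq_b pf g eT); lia.
split.
- move=> k l v; rewrite /V; upd_split; try lia; exact: (pf_shifted pf).
- by move=> k l m n x y; rewrite !dV; apply: (pf_convex pf).
- move=> k l m n q1 q2; rewrite /V; upd_split=> // h1 h2.
  + by case: h1 h2 => <- [<-]; fin.
  + by case: h1 => <-; move: (aa_facts pf cm h2) (ab_facts pf mb h2 eT); fin.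
  + case: h2 => <-; case: q1 h1 => h1; first by fin.
    by move: (aa_facts pf cm h1) (ab_facts pf mb h1 e) (ab_facts pf mb h1 eT); fin.
  + exact: (pf_a pf h1 h2).
- move=> k l m n q1 q2; rewrite /V; upd_split=> // h1 h2;
    rewrite -?(inr_inj (Some_inj h1)) -?(inr_inj (Some_inj h2)); try by fin.
  + by move: (bb_facts pf e h2) (bb_facts pf eT h2) (ab_facts pf mb cm h2); fin.
  + by move: (bb_facts pf e h2) (bb_facts pf eT h2) (ab_facts pf mb cm h2); fin.
  + by move: (bb_facts pf e h1) (bb_facts pf eT h1) (ab_facts pf mb cm h1); fin.
  + by move: (bb_facts pf e h1) (bb_facts pf eT h1) (ab_facts pf mb cm h1); fin.
  + exact: (pf_b pf h1 h2).
- move=> k q1; rewrite /V; upd_split=> //; [by case|exact: (pf_diag_a pf)].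
- move=> k q1; rewrite /V; upd_split=> //; [lia|by case|exact: (pf_diag_b pf)].
- move=> k l q1 q2; rewrite /V; upd_split=> // h1 h2.
  + by move: (pf_uniq_a pf cm h2); lia.
  + by move: (pf_uniq_a pf cm h1); lia.
  + exact: (pf_uniq_a pf h1 h2).
- move=> k l q1 q2; rewrite /V; upd_split=> // h1 h2; try lia.
  + by move: (pf_uniq_b pf eT h2); lia.
  + by move: (pf_uniq_b pf eT h1); lia.
  + exact: (pf_uniq_b pf h1 h2).
- move=> k l m n h1 h2 km ln.
  set w := V k n; move: h1 h2; rewrite {1 2}/V; upd_split=> // h1 h2; try lia; rewrite {}/w.
  + by have [||] := pf_corner0 pf cm h2; lia.
  + by move: (no0 _ _ h1) (aa_facts pf cm h1); fin.
  + have [mk e0] := pf_corner0 pf h1 h2 km ln.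
    by split=> //; rewrite /V; upd_split=> //; move: (pf_shifted pf h1); lia.
- move=> k l m n h1 h2 km ln.
  set w := V k n; move: h1 h2; rewrite {1 2}/V; upd_split=> // h1 h2; try lia; rewrite {}/w.
  have [mk e0] := pf_corner1 pf h1 h2 km ln.
  by split=> //; rewrite /V; upd_split=> //; move: (pf_shifted pf h1); lia.
- move=> k l p1 m n q1 x y r x' y' r' h1 h2 h3 h4; apply/negP => /and5P[bef xk yl mx' ny'].
  have up : exists u v t, [/\ s u v = Some (inr t), x' <= u & y' <= v].
    move: h4; rewrite /V; upd_split=> // h4; last by exists x', y', r'.
      by exists i, i.+1, true; split=> //; lia.
    by exists i, i.+1, true; split=> //; lia.
  have dn : (exists t, s x y = Some (inr t)) \/ (i <= x /\ i <= y).
    by move: h3; rewrite /V; upd_split=> // h3; [right; lia|right|left; exists r].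
  move: h1 h2; rewrite /V; upd_split=> // h1 h2.
  + by move: h1 h2 bef => [<-] [<-]; fin.
  + have kc := unfinished pf mb h2 up mx' ny' ltac:(done).
    by move: h1 kc bef (aa_facts pf cm h2) => [<-]; fin.
  + apply: (unmoved pf mb h1 _ dn xk yl).
    by move: h2 bef (aa_facts pf cm h1) => [<-]; fin.
  + have kc := unfinished pf mb h2 up mx' ny' ltac:(done).
    apply: (unmoved pf mb h1 _ dn xk yl).
    by move: bef kc; fin.
Qed.

(* (S4) and (S7) *)
Lemma perforated_rotate s i : perforated s -> mobile s i i.+1 false ->
  s i i = Some (inl false) -> s i.+1 i.+1 = Some (inr false) ->
  (forall q, s i i.+2 = Some (inr q) -> q = false) ->
  perforated (upd (upd (upd s i i (inr false)) i i.+1 (inl true)) i.+1 i.+1 (inl false)).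
Proof.
move=> pf mb eO e hE; have cm := mb_at mb.
set V := upd _ _ _ _.
have dV k l : isSome (V k l) = isSome (s k l).
  by rewrite !upd_dom ?cm // ?e ?eO.
(* The a-box at [(i, i)] precedes the moving one, so it has not been moved. *)
have nolow k l r : s k l = Some (inr r) -> k <= i -> l <= i -> False.
  by move=> h ki li; move: (ab_facts pf mb eO h); fin.
have no0 k l : s k l = Some (inl false) -> l <= i.+1 -> ~~ ((k == i) && (l == i)) ->
    ~~ ((k == i) && (l == i.+1)) -> False.
  move=> h li nO nc; have kl := pf_shifted pf h.
  have [li1|li1] := ltnP l i; last by move: (aa_facts pf cm h) (aa_facts pf eO h); fin.
  have: s i.-1 i.-1 by apply: (pf_convex pf (i := k) (j := l) (k := i) (l := i)); rewrite ?eO ?h //; lia.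
  case g: (s i.-1 i.-1) => [[q'|t]|//] _.
    by move: (pf_uniq_a pf g eO); lia.
  by case: (nolow _ _ _ g); lia.
have row k l r : s k l = Some (inr r) -> i.+1 < l -> i <= k -> s i i.+2 = Some (inr false).
  move=> h il ik; have [||||q g] := between_cb pf mb (x := i) (y := i.+2) h; try lia.
  by rewrite g (hE _ g).
split.
- move=> k l v; rewrite /V; upd_split; try lia; exact: (pf_shifted pf).
- by move=> k l m n x y; rewrite !dV; apply: (pf_convex pf).
- move=> k l m n q1 q2; rewrite /V; upd_split=> // h1 h2;
    rewrite -?(inl_inj (Some_inj h1)) -?(inl_inj (Some_inj h2)); try by fin.
  + by move: (aa_facts pf cm h2) (ab_facts pf mb h2 e); fin.
  + by move: (aa_facts pf cm h2) (ab_facts pf mb h2 e); fin.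
  + case: q1 h1 => h1; first by fin.
    by move: (no0 _ _ h1); fin.
  + case: q1 h1 => h1; last by move: (no0 _ _ h1); fin.
    by move: (aa_facts pf eO h1) (aa_facts pf cm h1); fin.
  + exact: (pf_a pf h1 h2).
- move=> k l m n q1 q2; rewrite /V; upd_split=> // h1 h2;
    rewrite -?(inr_inj (Some_inj h1)) -?(inr_inj (Some_inj h2)); try by fin.
  + have [/andP[/eqP mi il]|nsp] := boolP [&& m == i & i.+1 < n].
      subst m; have g := row _ _ _ h2 il (leqnn i).
      by move: (bb_facts pf g h2); fin.
    by move: (bb_facts pf e h2) (ab_facts pf mb cm h2) (ab_facts pf mb eO h2); fin.
  + by move: (nolow _ _ _ h1); fin.
  + exact: (pf_b pf h1 h2).
- move=> k q1; rewrite /V; upd_split=> //; [by case|lia|exact: (pf_diag_a pf)].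
- move=> k q1; rewrite /V; upd_split=> //; [by case|exact: (pf_diag_b pf)].
- move=> k l q1 q2; rewrite /V; upd_split=> // h1 h2; try lia.
  + by move: (pf_uniq_a pf eO h2); lia.
  + by move: (pf_uniq_a pf eO h1); lia.
  + exact: (pf_uniq_a pf h1 h2).
- move=> k l q1 q2; rewrite /V; upd_split=> // h1 h2; try lia.
  + by move: (pf_uniq_b pf e h2); lia.
  + by move: (pf_uniq_b pf e h1); lia.
  + exact: (pf_uniq_b pf h1 h2).
- move=> k l m n h1 h2 km ln.
  set w := V k n; move: h1 h2; rewrite {1 2}/V; upd_split=> // h1 h2; try lia; rewrite {}/w.
  + by have [||] := pf_corner0 pf cm h2; lia.
  + by case: (no0 _ _ h1); lia.
  + have [mk e0] := pf_corner0 pf h1 h2 km ln.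
    by split=> //; rewrite /V; upd_split=> //; move: (pf_shifted pf h1); lia.
- move=> k l m n h1 h2 km ln.
  set w := V k n; move: h1 h2; rewrite {1 2}/V; upd_split=> // h1 h2; try lia; rewrite {}/w.
  + by move: (aa_facts pf cm h2); fin.
  + have kl := pf_shifted pf h1.
    have: s k i.+1 by apply: (pf_convex pf (i := k) (j := l) (k := i) (l := i.+1)); rewrite ?cm ?h1 //; lia.
    case g: (s k i.+1) => [[q'|r]|//] _.
      by move: (aa_facts pf h1 g) (aa_facts pf g cm); fin.
    have r1 : r = true by move: (bb_facts pf g e); fin.
    rewrite r1 in g.
    have li : l = i.
      have: s k i by apply: (pf_convex pf (i := k) (j := l) (k := i) (l := i)); rewrite ?eO ?h1 //; lia.
      case f: (s k i) => [[q'|t]|//] _.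
        by move: (aa_facts pf h1 f) (aa_facts pf f eO); fin.
      by case: (nolow _ _ _ f); lia.
    by split; [lia|rewrite /V; upd_split=> //; lia].
  + have [mk e0] := pf_corner1 pf h1 h2 km ln.
    by split=> //; rewrite /V; upd_split=> //; move: (pf_shifted pf h1); lia.
- move=> k l p1 m n q1 x y r x' y' r' h1 h2 h3 h4; apply/negP => /and5P[bef xk yl mx' ny'].
  have up : exists u v t, [/\ s u v = Some (inr t), x' <= u & y' <= v].
    move: h4; rewrite /V; upd_split=> // h4; last by exists x', y', r'.
    by exists i.+1, i.+1, false; split=> //; lia.
  (* Primed a-boxes precede the moving unprimed one and have not been moved; none of them is
     south-east of the new b-box at [(i, i)]. *)
  have primed_still u v : s u v = Some (inl true) -> x <= u -> y <= v -> False.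
    move=> h xu yv; move: h3; rewrite /V; upd_split=> // h3.
      by move: (aa_facts pf eO h); fin.
    by move: (mb_before mb h h3); fin.
  move: h1 h2; rewrite /V; upd_split=> // h1 h2.
  + by move: h1 h2 bef => [<-] [<-]; fin.
  + by move: h1 h2 bef => [<-] [<-]; fin.
  + have kc := unfinished pf mb h2 up mx' ny' ltac:(done).
    by case: q1 h2 kc bef => h2; [case: h1 => <-; fin|move: (no0 _ _ h2); fin].
  (* The [a'] now at [(i, i.+1)] has a b-box to its north-west, so the a-box at [(i.+1, i.+1)] must
     be at rest: a b-box south-east of it would lie below an unprimed one of row [i] in its
     column. *)
  + move: h4; rewrite /V; upd_split=> // h4; first by lia.
    have yy := pf_shifted pf h4.
    have g := row _ _ _ h4 ltac:(lia) ltac:(lia).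
    have [||||t f] := between_cb pf mb (x := i) (y := y') h4; try lia.
    by move: (bb_facts pf g f) (bb_facts pf f h4); fin.
  + by move: h1 h2 bef => [<-] [<-]; fin.
  + have kc := unfinished pf mb h2 up mx' ny' ltac:(done).
    case: q1 h2 kc bef => h2; last by move: (no0 _ _ h2); fin.
    by case: h1 => <-; move: (aa_facts pf cm h2); fin.
  + case: p1 h1 bef => h1; first by case: (primed_still _ _ h1).
    by case: h2 => <-; move: (no0 _ _ h1); fin.
  + case: p1 h1 bef => h1; first by case: (primed_still _ _ h1).
    by case: h2 => <-; fin.
  + have kc := unfinished pf mb h2 up mx' ny' ltac:(done).
    case: q1 h2 kc bef => h2; last by move: (no0 _ _ h2); fin.
    case: p1 h1 => h1; first by case: (primed_still _ _ h1).
    by fin.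
Qed.

(** * The process *)

(** Walk from the a-box towards the b-box, east first so as to stay above the diagonal, then south.
    Convexity keeps the walk inside the filling, and the last a-box before the first b-box is the
    one sought. *)
Lemma find_active s k l q m n r : perforated s ->
  s k l = Some (inl q) -> s m n = Some (inr r) -> k <= m -> l <= n ->
  exists k' l' q', [/\ s k' l' = Some (inl q'), k <= k', l <= l' &
    (exists t, s k' l'.+1 = Some (inr t)) \/ (exists t, s k'.+1 l' = Some (inr t))].
Proof.
move=> pf; have [d] := ubnP ((m - k) + (n - l)).
elim: d k l q => // d IHd k l q led hk hm km ln.
have mn := pf_shifted pf hm.
have next x y : s x y -> k <= x <= m -> l <= y <= n -> (m - x) + (n - y) < d ->
    (forall t, s x y <> Some (inr t)) ->
    exists k' l' q', [/\ s k' l' = Some (inl q'), k <= k', l <= l' &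
    (exists t, s k' l'.+1 = Some (inr t)) \/ (exists t, s k'.+1 l' = Some (inr t))].
  case e: (s x y) => [[q'|t]|//] _ kx ly lt ne; last by case: (ne t).
  have [|||k' [l' [q'' [h1 h2 h3 h4]]]] := IHd _ _ _ _ e hm; try lia.
  by exists k', l', q''; split=> //; lia.
have [lt|le] := ltnP l n.
  have dx : s k l.+1.
    apply: (pf_convex pf (i := k) (j := l) (k := m) (l := n)); rewrite ?hk ?hm //; try lia.
    by move: (pf_shifted pf hk); lia.
  case e: (s k l.+1) (dx) => [[q'|t]|//] _.
    by apply: (next k l.+1) => //; rewrite ?e //; lia.
  by exists k, l, q; split=> //; left; exists t.
have {le} nl : l = n by lia.
subst n.
have [lt|le] := ltnP k m; last first.
  by move: hm; rewrite (_ : m = k) ?hk //; lia.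
have dx : s k.+1 l.
  by apply: (pf_convex pf (i := k) (j := l) (k := m) (l := l)); rewrite ?hk ?hm //; lia.
case e: (s k.+1 l) (dx) => [[q'|t]|//] _.
  by apply: (next k.+1 l) => //; rewrite ?e //; lia.
by exists k, l, q; split=> //; right; exists t.
Qed.

(** The active a-box that is last in the order is mobile: being active it is not at rest, so
    [pf_moved] protects the boxes before it; a later box not at rest would, by [find_active], give a
    later active one. *)
Lemma mobileP s i j p : perforated s -> s i j = Some (inl p) ->
  (exists t, s i j.+1 = Some (inr t)) \/ (exists t, s i.+1 j = Some (inr t)) ->
  (forall k l q, s k l = Some (inl q) ->
    (exists t, s k l.+1 = Some (inr t)) \/ (exists t, s k.+1 l = Some (inr t)) ->
    ~~ before p i j q k l) ->
  mobile s i j p.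
Proof.
move=> pf cm act last; split=> // k l q m n r hk hm.
  by case: act => -[t ht]; move: (pf_moved pf hk cm hm ht); lia.
apply/negP => /and3P[bef km ln].
have [k' [l' [q' [h1 h2 h3 h4]]]] := find_active pf hk hm km ln.
by move: (last _ _ _ h1 h4) bef (aa_facts pf hk h1) (aa_facts pf cm h1) (aa_facts pf cm hk); fin.
Qed.

(** * From pair fillings to cells *)

Section Bridge.
Variables a b : nat.

Definition cells_of (U : pair_filling) : cells := fun i j =>
  match U.[? (i, j)]%fmap with
  | Some (inl x) => if num x == a then Some (inl (primed x)) else None
  | Some (inr x) => if num x == b then Some (inr (primed x)) else None
  | None => None
  end.

Lemma a_entryE U i j :
  a_entry a U (i, j) = if cells_of U i j is Some (inl p) then Some p else None.
Proof.
rewrite /a_entry /cells_of; case: fnd => // -[x|x]; first by case: eqP.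
by case: eqP.
Qed.

Lemma b_entryE U i j :
  b_entry b U (i, j) = if cells_of U i j is Some (inr p) then Some p else None.
Proof.
rewrite /b_entry /cells_of; case: fnd => // -[x|x]; last by case: eqP.
by case: eqP.
Qed.

Lemma cells_a_put U k l p i j :
  cells_of (a_put a U (k, l) p) i j = upd (cells_of U) k l (inl p) i j.
Proof. by rewrite /cells_of /upd fnd_set xpair_eqE; case: ifP; rewrite //= eqxx. Qed.

Lemma cells_b_put U k l p i j :
  cells_of (b_put b U (k, l) p) i j = upd (cells_of U) k l (inr p) i j.
Proof. by rewrite /cells_of /upd fnd_set xpair_eqE; case: ifP; rewrite //= eqxx. Qed.

(** Matches the branches of [switch] with the preservation lemmas; [pf_diag_a] and [pf_diag_b]
    dispose of the primed diagonal entries. *)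
Lemma perforated_switch U i j p : perforated (cells_of U) ->
  mobile (cells_of U) i j p -> perforated (cells_of (switch a b U (i, j))).
Proof.
move=> pf mb; have cm := mb_at mb; have ij := pf_shifted pf cm.
have south r : cells_of U i.+1 j = Some (inr r) ->
    (forall q, cells_of U i j.+1 = Some (inr q) -> q = false) ->
    (j = i.+1 -> p = false /\ forall q, cells_of U i i <> Some (inl q)) ->
    perforated (cells_of (a_put a (b_put b U (i, j) r) (i.+1, j) p)).
  move=> f hE hd; apply: (perforated_ext _ (perforated_south pf mb f hE hd)) => k l.
  by rewrite cells_a_put /upd cells_b_put.
have east q : cells_of U i j.+1 = Some (inr q) ->
    (forall r, cells_of U i.+1 j = Some (inr r) -> q) -> (i = j -> q = false) ->
    perforated (cells_of (a_put a (b_put b U (i, j) q) (i, j.+1) p)).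
  move=> f hS hd; apply: (perforated_ext _ (perforated_east pf mb f hS hd)) => k l.
  by rewrite cells_a_put /upd cells_b_put.
have east_only q : cells_of U i j.+1 = Some (inr q) ->
    (forall r, cells_of U i.+1 j <> Some (inr r)) ->
    perforated (cells_of (if (j == i) && q then
        if b_entry b U (i.+1, i.+1) is Some r
        then a_put a (b_put b (b_put b U (i, j) r) (i, j.+1) false) (i.+1, i.+1) p
        else if p then a_put a (b_put b U (i, j) q) (i, j.+1) p
        else a_put a (b_put b U (i, j) false) (i, j.+1) true
      else a_put a (b_put b U (i, j) q) (i, j.+1) p)).
  move=> e hS; case: eqP => [ji|ji] /=; last by apply: east => // [r /hS//|/esym].
  subst j; have p0 := pf_diag_a pf cm; move: mb cm; rewrite p0 => mb0 cm0 {south east}.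
  case: q e => e; last first.
    apply: (perforated_ext _ (perforated_east pf mb0 e _ _)) => // [k l|r /hS//].
    by rewrite cells_a_put /upd cells_b_put.
  have e0 := e; rewrite b_entryE; case f: (cells_of U i.+1 i.+1) => [[?|r]|].
  - apply: (perforated_ext _ (perforated_east' pf mb0 e _)) => [k l|r]; last by rewrite f.
    by rewrite cells_a_put /upd cells_b_put.
  - have r0 := pf_diag_b pf f; subst r.
    apply: (perforated_ext _ (perforated_shift pf mb0 e f)) => k l.
    by rewrite cells_a_put /upd !cells_b_put /upd cells_b_put.
  - apply: (perforated_ext _ (perforated_east' pf mb0 e _)) => [k l|r]; last by rewrite f.
    by rewrite cells_a_put /upd cells_b_put.
have south_only r : cells_of U i.+1 j = Some (inr r) ->
    (forall q, cells_of U i j.+1 = Some (inr q) -> q = false) ->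
    perforated (cells_of (if j == i.+1 then
        if p then if r then a_put a (b_put b U (i, j) r) (i.+1, j) p
          else a_put a (b_put b U (i, j) true) (i.+1, j) false
        else if a_entry a U (i, i) is Some p0
          then a_put a (a_put a (b_put b U (i, i) r) (i, j) true) (i.+1, j) p0
          else a_put a (b_put b U (i, j) r) (i.+1, j) p
      else a_put a (b_put b U (i, j) r) (i.+1, j) p)).
  move=> e hE; case: eqP => [ji|ji]; last by apply: south.
  subst j; have r0 := pf_diag_b pf e; subst r.
  case: ifP => p0.
    move: mb; rewrite p0 => mb1.
    apply: (perforated_ext _ (perforated_south' pf mb1 e hE)) => k l.
    by rewrite cells_a_put /upd cells_b_put.
  rewrite a_entryE; case f: (cells_of U i i) => [[t|?]|]; try by apply: south => // _; split=> // q; rewrite f.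
  have t0 := pf_diag_a pf f; subst t.
  move: mb; rewrite p0 => mb0.
  apply: (perforated_ext _ (perforated_rotate pf mb0 f e hE)) => k l.
  by rewrite cells_a_put /upd cells_a_put /upd cells_b_put.
rewrite /switch a_entryE cm /Defs.east /Defs.south /= (b_entryE U i j.+1) (b_entryE U i.+1 j).
case e: (cells_of U i j.+1) => [[?|q]|];
  case f: (cells_of U i.+1 j) => [[?|r]|] //; try by [apply: south_only => // ?; rewrite e|apply: east_only => // ?; rewrite f].
case: q e => e; first by apply: east => // ji; move: (pf_shifted pf f); lia.
have hE q : cells_of U i j.+1 = Some (inr q) -> q = false by rewrite e => -[].
move: (south_only _ f hE); case: eqP => // ji; subst j; have r0 := pf_diag_b pf f; subst r.
case: ifP => [p1 pf'|-> //].
(* In [S6'] the east box is rewritten with the entry it already has, so the result agrees pointwise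
   with that of [S2']. *)
apply: perforated_ext pf' => k l.
rewrite !cells_a_put /upd !cells_b_put /upd ?cells_b_put /upd.
repeat (case: ifP => [/andP[/eqP ? /eqP ?]|/negbT ?]; subst) => //; try lia; by rewrite e.
Qed.


Lemma activeP U p i j : reflect (cells_of U i j = Some (inl p) /\
    ((exists t, cells_of U i j.+1 = Some (inr t)) \/ (exists t, cells_of U i.+1 j = Some (inr t))))
  (active a b p U (i, j)).
Proof.
rewrite /active a_entryE /east /south /= !b_entryE.
apply: (iffP andP) => -[h1 h2]; split.
- by case: (cells_of U i j) h1 => [[q|q]|] // /eqP [->].
- case: (cells_of U i j.+1) h2 => [[q|q]|] /=.
  + by case: (cells_of U i.+1 j) => [[t|t]|] // _; right; exists t.
  + by left; exists q.
  + by case: (cells_of U i.+1 j) => [[t|t]|] // _; right; exists t.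
- by rewrite h1.
- by case: h2 => -[t ->] //=; rewrite orbT.
Qed.

(** Easternmost among the unprimed, else southernmost among the primed: this is the last active box
    for [before], as [mobileP] demands. *)
Lemma is_Box_mobile U i j : perforated (cells_of U) -> is_Box a b U (i, j) ->
  exists p, mobile (cells_of U) i j p /\ active a b p U (i, j).
Proof.
move=> pf; have dom p c : active a b p U c -> c \in domf U.
  by case/andP=> /eqP h _; apply: (@a_entry_dom a); rewrite h.
have act p k l (h : active a b p U (k, l)) : exists d : domf U, val d = (k, l).
  by exists [` dom _ _ h]%fset.
rewrite /is_Box; case: ifP => [_|/negbT/existsPn no] /andP[h /forallP mx].
  have [h1 h2] := activeP _ _ _ _ h; exists false; split=> //; apply: mobileP => // k l q hk hact.
  have [//|q0] := boolP q; move: hk; rewrite (negbTE q0) => hk.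
  have hk' : active a b false U (k, l) by apply/activeP.
  by have [d dE] := act _ _ _ hk'; move: (mx d); rewrite dE hk' /=; fin.
have [h1 h2] := activeP _ _ _ _ h; exists true; split=> //; apply: mobileP => // k l q hk hact.
have hk' : active a b q U (k, l) by apply/activeP.
have [d dE] := act _ _ _ hk'.
case: q hk hk' => hk hk'; last by move: (no d); rewrite dE hk'.
by move: (mx d); rewrite dE hk' /=; fin.
Qed.

(** * Shape and letter counts under a switch *)

Definition ab (U : pair_filling) (c : box) : bool := a_entry a U c || b_entry b U c.

Definition holds_at (P : letter + letter -> bool) (U : pair_filling) (c : box) : bool :=
  if U.[? c]%fmap is Some x then P x else false.

Definition occ (P : letter + letter -> bool) (U : pair_filling) : nat :=
  \sum_(c <- domf U) holds_at P U c.

(* The switches may change primes, so only such [P] keep their [occ]. *)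
Definition unprimed_pred (P : letter + letter -> bool) : Prop :=
  forall k p q, P (inl (k, p)) = P (inl (k, q)) /\ P (inr (k, p)) = P (inr (k, q)).

(** [fr_ab] fixes the region of the two letters, so that frames compose and entries outside it
    persist through a whole process. *)
Record frame (U V : pair_filling) : Prop := Frame {
  fr_dom : domf V = domf U;
  fr_out : forall c, ~~ ab U c -> V.[? c]%fmap = U.[? c]%fmap;
  fr_ab : forall c, ab V c = ab U c;
  fr_occ : forall P, unprimed_pred P -> occ P V = occ P U
}.

Lemma frame_trans U V W : frame U V -> frame V W -> frame U W.
Proof.
move=> [d1 o1 a1 n1] [d2 o2 a2 n2]; split=> [|c h|c|P h].
- by rewrite d2.
- by rewrite o2 ?a1 // o1.
- by rewrite a2.
- by rewrite n2 // n1.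
Qed.

(** Stated with sums on both sides, since subtraction on [nat] truncates. *)
Lemma occ_set P (U : pair_filling) x v : x \in domf U ->
  occ P U.[x <- v]%fmap + holds_at P U x = occ P U + P v.
Proof.
move=> xU; rewrite /occ domf_set_in // !(bigD1_seq x) ?fset_uniq //=.
have -> : \sum_(i <- domf U | i != x) (holds_at P U.[x <- v]%fmap i : nat)
  = \sum_(i <- domf U | i != x) (holds_at P U i : nat).
  by apply: eq_bigr => i /negbTE ix; rewrite /holds_at fnd_set ix.
by rewrite {1}/holds_at fnd_set eqxx -addnA addnC (addnC (holds_at P U x : nat)).
Qed.

Lemma ab_put U x v : ab U x -> (exists p, v = inl (a, p)) \/ (exists p, v = inr (b, p)) ->
  [/\ domf U.[x <- v]%fmap = domf U, forall c, ~~ ab U c -> U.[x <- v].[? c]%fmap = U.[? c]%fmap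
    & forall c, ab U.[x <- v]%fmap c = ab U c].
Proof.
move=> abx hv; have xU : x \in domf U.
  by case/orP: abx => [/a_entry_dom|/b_entry_dom].
split=> [|c nc|c]; first by rewrite domf_set_in.
  by rewrite fnd_set; case: eqP => // cx; rewrite cx abx in nc.
rewrite /ab /a_entry /b_entry fnd_set; case: eqP => [->|] //.
rewrite -/(a_entry a U x) -/(b_entry b U x) -/(ab U x) abx.
by case: hv => -[p ->] /=; rewrite eqxx ?orbT.
Qed.

Lemma a_entry_fnd U c p : a_entry a U c = Some p -> U.[? c]%fmap = Some (inl (a, p)).
Proof.
by rewrite /a_entry; case: (U.[? c]%fmap) => // -[[k q]|//] /=; case: eqP => // -> [->].
Qed.

Lemma b_entry_fnd U c p : b_entry b U c = Some p -> U.[? c]%fmap = Some (inr (b, p)).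
Proof.
by rewrite /b_entry; case: (U.[? c]%fmap) => // -[//|[k q]] /=; case: eqP => // -> [->].
Qed.


(** [switch] writes in three patterns, treated here and in [frame_shift] and [frame_rotate]; each
    permutes the letters up to primes. *)
Lemma frame_swap U x y p0 q0 p q : a_entry a U x = Some p0 -> b_entry b U y = Some q0 ->
  frame U (a_put a (b_put b U x q) y p).
Proof.
move=> ax b_y; have [fx fy] := (a_entry_fnd ax, b_entry_fnd b_y).
have abx : ab U x by rewrite /ab ax.
have aby : ab U y by rewrite /ab b_y orbT.
have xy : (y == x) = false by apply/eqP => xy; rewrite xy fx in fy.
have [d1 o1 e1] := ab_put abx (or_intror (ex_intro _ q erefl)).
have := @ab_put U.[x <- inr (b, q)]%fmap y (inl (a, p)); rewrite e1 => /(_ aby).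
case; first by left; exists p.
move=> d2 o2 e2; split=> [|c nc|c|P hP].
- by rewrite d2.
- by rewrite o2 ?e1 // o1.
- by rewrite e2 e1.
have xU : x \in domf U by apply: (@a_entry_dom a); rewrite ax.
have yU : y \in domf U by apply: (@b_entry_dom b); rewrite b_y.
have := @occ_set P U x (inr (b, q)) xU; have := @occ_set P U.[x <- inr (b, q)]%fmap y (inl (a, p)).
rewrite d1 => /(_ yU); rewrite /holds_at fnd_set xy fx fy /a_put /b_put.
by have [-> _] := hP a p p0; have [_ ->] := hP b q q0; lia.
Qed.

Lemma frame_shift U x y z p0 q0 r0 p q r : a_entry a U x = Some p0 ->
  b_entry b U y = Some q0 -> b_entry b U z = Some r0 -> y != z ->
  frame U (a_put a (b_put b (b_put b U x q) y r) z p).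
Proof.
move=> ax b_y bz yz; have [fx fy fz] := And3 (a_entry_fnd ax) (b_entry_fnd b_y) (b_entry_fnd bz).
have abx : ab U x by rewrite /ab ax.
have aby : ab U y by rewrite /ab b_y orbT.
have abz : ab U z by rewrite /ab bz orbT.
have yx : (y == x) = false by apply/eqP => yx; rewrite yx fx in fy.
have zx : (z == x) = false by apply/eqP => zx; rewrite zx fx in fz.
have zy : (z == y) = false by rewrite eq_sym (negbTE yz).
have [d1 o1 e1] := ab_put abx (or_intror (ex_intro _ q erefl)).
have := @ab_put U.[x <- inr (b, q)]%fmap y (inr (b, r)); rewrite e1 => /(_ aby).
case; first by right; exists r.
move=> d2 o2 e2.
have := @ab_put U.[x <- inr (b, q)].[y <- inr (b, r)]%fmap z (inl (a, p)); rewrite e2 e1 => /(_ abz).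
case; first by left; exists p.
move=> d3 o3 e3; split=> [|c nc|c|P hP].
- by rewrite d3 d2.
- by rewrite o3 ?e2 ?e1 // o2 ?e1 // o1.
- by rewrite e3 e2 e1.
have xU : x \in domf U by apply: (@a_entry_dom a); rewrite ax.
have yU : y \in domf U by apply: (@b_entry_dom b); rewrite b_y.
have zU : z \in domf U by apply: (@b_entry_dom b); rewrite bz.
have := @occ_set P U x (inr (b, q)) xU; have := @occ_set P U.[x <- inr (b, q)]%fmap y (inr (b, r)).
have := @occ_set P U.[x <- inr (b, q)].[y <- inr (b, r)]%fmap z (inl (a, p)).
rewrite d2 d1 => /(_ zU) h3 /(_ yU); move: h3.
rewrite /holds_at !fnd_set zx zy yx fx fy fz /a_put /b_put.
have [-> _] := hP a p p0; have [_ ->] := hP b q q0; have [_ ->] := hP b r q0; have [_ ->] := hP b r0 q0.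
by move: (nat_of_bool (P (inl (a, p0)))) (nat_of_bool (P (inr (b, q0)))) => u v; lia.
Qed.

Lemma frame_rotate U x y z p0 q0 r0 p q r : a_entry a U x = Some p0 ->
  a_entry a U y = Some q0 -> b_entry b U z = Some r0 -> x != y ->
  frame U (a_put a (a_put a (b_put b U x q) y r) z p).
Proof.
move=> ax ay bz xy; have [fx fy fz] := And3 (a_entry_fnd ax) (a_entry_fnd ay) (b_entry_fnd bz).
have abx : ab U x by rewrite /ab ax.
have aby : ab U y by rewrite /ab ay.
have abz : ab U z by rewrite /ab bz orbT.
have yx : (y == x) = false by rewrite eq_sym (negbTE xy).
have zx : (z == x) = false by apply/eqP => zx; rewrite zx fx in fz.
have zy : (z == y) = false by apply/eqP => zy; rewrite zy fy in fz.
have [d1 o1 e1] := ab_put abx (or_intror (ex_intro _ q erefl)).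
have := @ab_put U.[x <- inr (b, q)]%fmap y (inl (a, r)); rewrite e1 => /(_ aby).
case; first by left; exists r.
move=> d2 o2 e2.
have := @ab_put U.[x <- inr (b, q)].[y <- inl (a, r)]%fmap z (inl (a, p)); rewrite e2 e1 => /(_ abz).
case; first by left; exists p.
move=> d3 o3 e3; split=> [|c nc|c|P hP].
- by rewrite d3 d2.
- by rewrite o3 ?e2 ?e1 // o2 ?e1 // o1.
- by rewrite e3 e2 e1.
have xU : x \in domf U by apply: (@a_entry_dom a); rewrite ax.
have yU : y \in domf U by apply: (@a_entry_dom a); rewrite ay.
have zU : z \in domf U by apply: (@b_entry_dom b); rewrite bz.
have := @occ_set P U x (inr (b, q)) xU; have := @occ_set P U.[x <- inr (b, q)]%fmap y (inl (a, r)).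
have := @occ_set P U.[x <- inr (b, q)].[y <- inl (a, r)]%fmap z (inl (a, p)).
rewrite d2 d1 => /(_ zU) h3 /(_ yU); move: h3.
rewrite /holds_at !fnd_set zx zy yx fx fy fz /a_put /b_put.
have [-> _] := hP a p p0; have [-> _] := hP a q0 p0; have [-> _] := hP a r p0; have [_ ->] := hP b q r0.
by move: (nat_of_bool (P (inl (a, p0)))) (nat_of_bool (P (inr (b, r0)))) => u v; lia.
Qed.

Lemma frame_switch p U c : active a b p U c -> frame U (switch a b U c).
Proof.
case: c => i j; rewrite /active => /andP[/eqP ap].
rewrite /switch; set E := east _; set S' := south _.
have ES : E != S' by apply/eqP => -[]; lia.
rewrite ap; case bE: (b_entry b U E) => [q|]; case bS: (b_entry b U S') => [r|] //= _.
- case: ifP => _; first exact: frame_swap ap bE.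
  case: eqP => [ji|_]; last exact: frame_swap ap bS.
  case: p ap => ap; first by case: r bS => bS; [exact: frame_swap ap bS|exact: frame_shift ap bE bS ES].
  case ai: (a_entry a U (i, i)) => [p0|]; last exact: frame_swap ap bS.
  by apply: (frame_rotate _ _ _ ai ap bS); apply/eqP => -[]; lia.
- case: ifP => [/andP[/eqP ji _]|_]; last exact: frame_swap ap bE.
  case bd: (b_entry b U _) => [r|].
    by apply: (frame_shift _ _ _ ap bE bd); apply/eqP => -[]; lia.
  by case: p ap => ap; exact: frame_swap ap bE.
- case: eqP => [ji|_]; last exact: frame_swap ap bS.
  case: p ap => ap; first by case: r bS => bS; exact: frame_swap ap bS.
  case ai: (a_entry a U (i, i)) => [p0|]; last exact: frame_swap ap bS.
  by apply: (frame_rotate _ _ _ ai ap bS); apply/eqP => -[]; lia.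
Qed.

Lemma process_correct U : perforated (cells_of U) ->
  [/\ perforated (cells_of (process a b U)), frame U (process a b U)
    & fully_switched a b (process a b U)].
Proof.
move=> pf; rewrite /process; case: ex_minnP => n full _.
suff [] : perforated (cells_of (iter n (step a b) U)) /\ frame U (iter n (step a b) U) by [].
elim: n {full} => [|n [pfn frn]] //=; set V := iter n _ U in pfn frn *.
rewrite /step; case: pickP => [[[i j] ijV] /= bx|_] //.
have [p [mb act]] := is_Box_mobile pfn bx.
by split; [exact: perforated_switch mb|exact: frame_trans frn (frame_switch act)].
Qed.

Lemma fully_switchedP U k l q m n r : perforated (cells_of U) -> fully_switched a b U ->
  cells_of U k l = Some (inl q) -> cells_of U m n = Some (inr r) -> ~~ ((k <= m) && (l <= n)).
Proof.
move=> pf /forallP full hk hm; apply/negP => /andP[km ln].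
have [k' [l' [q' [h1 _ _ h4]]]] := find_active pf hk hm km ln.
have act : active a b q' U (k', l') by apply/activeP.
have dom : (k', l') \in domf U.
  by case/andP: act => /eqP h _; apply: (@a_entry_dom a); rewrite h.
by move: (full [` dom]%fset); case: q' {h1} act => act /=; rewrite act ?andbF.
Qed.

End Bridge.

(** * Exchange of two letters *)

Definition kind (x : letter + letter) : nat + nat :=
  match x with inl y => inl (num y) | inr y => inr (num y) end.

Definition mark (x : letter + letter) : bool :=
  match x with inl y => primed y | inr y => primed y end.

(* The order of the letters at a stage of the switching: [X i j] tells whether
   the letters [i] of S have already been moved past the letters [j] of T. *)
Definition kle (X : nat -> nat -> bool) (u v : nat + nat) : bool :=
  match u, v with
  | inl i, inl i' => i <= i'
  | inr j, inr j' => j <= j'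
  | inl i, inr j => ~~ X i j
  | inr j, inl i => X i j
  end.

Definition in_range (m n : nat) (u : nat + nat) : bool :=
  match u with inl i => 0 < i <= m | inr j => 0 < j <= n end.

(** The shape enters only through convexity; the partition separating the two final parts is
    recovered at the end, in [switched_shapes]. *)
Record tableau (m n : nat) (X : nat -> nat -> bool) (U : pair_filling) : Prop := Tableau {
  tb_shifted : forall i j x, U.[? (i, j)]%fmap = Some x -> i <= j;
  tb_convex : forall i j k l x y, U.[? (i, j)]%fmap -> U.[? (k, l)]%fmap ->
    i <= x <= k -> j <= y <= l -> x <= y -> U.[? (x, y)]%fmap;
  tb_range : forall c x, U.[? c]%fmap = Some x -> in_range m n (kind x);
  tb_le : forall i j k l x y, U.[? (i, j)]%fmap = Some x -> U.[? (k, l)]%fmap = Some y ->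
    i <= k -> j <= l -> kle X (kind x) (kind y);
  tb_ordered : forall i j k l x y, U.[? (i, j)]%fmap = Some x -> U.[? (k, l)]%fmap = Some y ->
    kind x = kind y -> ordered (mark x) (mark y) i j k l;
  tb_diag : forall i x, U.[? (i, i)]%fmap = Some x -> mark x = false
}.

Lemma tableau_ext m n X Y (U : pair_filling) : (forall i j, 0 < i <= m -> 0 < j <= n -> X i j = Y i j) ->
  tableau m n X U -> tableau m n Y U.
Proof.
move=> XY [H1 H2 H3 H4 H5 H6]; split=> // i j k l x y hx hy ik jl.
move: (H3 _ _ hx) (H3 _ _ hy) (H4 _ _ _ _ _ _ hx hy ik jl).
by case: x {hx} => x; case: y {hy} => y //= rx ry; rewrite XY.
Qed.

Section Stage.
Variables (m n a b : nat) (X : nat -> nat -> bool).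
Hypotheses (ma : 0 < a <= m) (nb : 0 < b <= n).
(** Together with [Xa], this says that the letter [a] of S immediately precedes the letter [b] of T
    in the current order. *)
Hypothesis Xb : forall i, 0 < i <= m -> X i b = (a < i).
Hypothesis Xa : forall j, 0 < j <= n -> X a j = (j < b).

Lemma cells_inl (U : pair_filling) i j p : cells_of a b U i j = Some (inl p) -> U.[? (i, j)]%fmap = Some (inl (a, p)).
Proof. by move=> h; apply: a_entry_fnd; rewrite (a_entryE a b) h. Qed.

Lemma cells_inr (U : pair_filling) i j p : cells_of a b U i j = Some (inr p) -> U.[? (i, j)]%fmap = Some (inr (b, p)).
Proof. by move=> h; apply: b_entry_fnd; rewrite (b_entryE a b) h. Qed.

Lemma cells_some (U : pair_filling) i j : cells_of a b U i j ->
  exists2 x, U.[? (i, j)]%fmap = Some x & kind x = inl a \/ kind x = inr b.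
Proof.
case e: (cells_of a b U i j) => [[p|p]|//] _.
  by exists (inl (a, p)); [exact: cells_inl|left].
by exists (inr (b, p)); [exact: cells_inr|right].
Qed.

Lemma cells_kind (U : pair_filling) i j x : U.[? (i, j)]%fmap = Some x -> kind x = inl a \/ kind x = inr b ->
  cells_of a b U i j.
Proof. by rewrite /cells_of => ->; case: x => x [] //= [->]; rewrite eqxx. Qed.

(** At the start no b-box is north-west of an a-box and no a-box is strictly south-east of another,
    so the corner fields and [pf_moved] hold vacuously. *)
Lemma tableau_perforated (U : pair_filling) : tableau m n X U -> perforated (cells_of a b U).
Proof.
move=> tb.
have ba i j k l q p : cells_of a b U i j = Some (inr q) -> cells_of a b U k l = Some (inl p) ->
    i <= k -> j <= l -> False.
  move=> /cells_inr h1 /cells_inl h2 ik jl.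
  by move: (tb_le tb h1 h2 ik jl) (Xb ma); rewrite /= => ->; rewrite ltnn.
(* A box between two boxes of these letters carries a letter between theirs; as [a] and [b] are
   adjacent, it is one of the two. *)
have convex i j k l x y : cells_of a b U i j -> cells_of a b U k l ->
    i <= x <= k -> j <= y <= l -> x <= y -> cells_of a b U x y.
  move=> h1 h2 ixk jyl xy; have [u hu ku] := cells_some h1; have [v hv kv] := cells_some h2.
  have: U.[? (x, y)]%fmap by apply: (tb_convex tb (i := i) (j := j) (k := k) (l := l)); rewrite ?hu ?hv.
  case hz: (U.[? (x, y)]%fmap) => [z|//] _.
  have uz := tb_le tb hu hz ltac:(lia) ltac:(lia); have zv := tb_le tb hz hv ltac:(lia) ltac:(lia).
  have uv := tb_le tb hu hv ltac:(lia) ltac:(lia); have rz := tb_range tb hz.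
  apply: (cells_kind hz); case: z uz zv rz {hz} => -[t pt] /= uz zv rz; [left|right];
    case: ku kv uz zv uv => -> [] -> /=; rewrite ?Xa ?Xb //; try lia;
    move=> *; congr (_ _); lia.
have corner i j k l p q : cells_of a b U i j = Some (inl p) -> cells_of a b U k l = Some (inl q) ->
    i < k -> j < l -> False.
  move=> h1 h2 ik jl.
  have ij := tb_shifted tb (cells_inl h1).
  have: cells_of a b U i l by apply: (convex i j k l); rewrite ?h1 ?h2 //; lia.
  case h: (cells_of a b U i l) => [[t|t]|//] _; last by apply: (ba _ _ _ _ _ _ h h2); lia.
  have [/cells_inl f1 /cells_inl f2 /cells_inl f] := And3 h1 h2 h.
  by move: (tb_ordered tb f1 f erefl) (tb_ordered tb f f2 erefl); rewrite /ordered /=; lia.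
split=> //.
- by move=> i j v h; have [|x hx _] := @cells_some U i j; [by rewrite h|exact: (tb_shifted tb hx)].
- by move=> i j k l p q /cells_inl h1 /cells_inl h2; apply: (tb_ordered tb h1 h2).
- by move=> i j k l p q /cells_inr h1 /cells_inr h2; apply: (tb_ordered tb h1 h2).
- by move=> i p /cells_inl /(tb_diag tb).
- by move=> i p /cells_inr /(tb_diag tb).
- have auniq i k p q : cells_of a b U i i = Some (inl p) -> cells_of a b U k k = Some (inl q) ->
      i < k -> False.
    move=> h1 h2 ik.
    have: cells_of a b U i k by apply: (convex i i k k); rewrite ?h1 ?h2 //; lia.
    case h: (cells_of a b U i k) => [[t|t]|//] _; last by apply: (ba _ _ _ _ _ _ h h2); lia.
    have [/cells_inl f1 /cells_inl f2 /cells_inl f] := And3 h1 h2 h.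
    move: (tb_ordered tb f1 f erefl) (tb_ordered tb f f2 erefl) (tb_diag tb f1) (tb_diag tb f2).
    by rewrite /ordered /=; lia.
  by move=> i k p q h1 h2; have [/(auniq _ _ _ _ h1 h2)|/(auniq _ _ _ _ h2 h1)|] := ltngtP i k.
- have buniq i k p q : cells_of a b U i i = Some (inr p) -> cells_of a b U k k = Some (inr q) ->
      i < k -> False.
    move=> h1 h2 ik.
    have: cells_of a b U i k by apply: (convex i i k k); rewrite ?h1 ?h2 //; lia.
    case h: (cells_of a b U i k) => [[t|t]|//] _; first by apply: (ba _ _ _ _ _ _ h1 h); lia.
    have [/cells_inr f1 /cells_inr f2 /cells_inr f] := And3 h1 h2 h.
    move: (tb_ordered tb f1 f erefl) (tb_ordered tb f f2 erefl) (tb_diag tb f1) (tb_diag tb f2).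
    by rewrite /ordered /=; lia.
  by move=> i k p q h1 h2; have [/(buniq _ _ _ _ h1 h2)|/(buniq _ _ _ _ h2 h1)|] := ltngtP i k.
- by move=> i j k l h1 h2 ik jl; case: (corner _ _ _ _ _ _ h1 h2).
- by move=> i j k l h1 h2 ik jl; case: (corner _ _ _ _ _ _ h1 h2).
- move=> i j p k l q x y r x' y' r' h1 h2 h3 h4.
  by apply/negP => /and5P[_ xi yj _ _]; apply: (ba _ _ _ _ _ _ h3 h1).
Qed.

Lemma ab_kind (U : pair_filling) i j x : U.[? (i, j)]%fmap = Some x ->
  ab a b U (i, j) <-> kind x = inl a \/ kind x = inr b.
Proof.
rewrite /ab /a_entry /b_entry => ->; case: x => x /=; case: eqP => [->|ne] /=.
- by split=> // _; left.
- by split=> // -[[/ne]|].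
- by split=> // _; right.
- by split=> // -[|[/ne]].
Qed.

(** Every third letter compares alike with the neighbours [a] and [b], so exchanging these two
    affects no comparison with it. Between [a] and [b] the new order holds because the result is
    fully switched, and within one letter because it is perforated. *)
Lemma tableau_process (U : pair_filling) : tableau m n X U ->
  tableau m n (fun i j => X i j || (i == a) && (j == b)) (process a b U).
Proof.
move=> tb; have [pf fr full] := process_correct (tableau_perforated tb).
set V := process a b U in pf fr full *.
have dV c : isSome (V.[? c]%fmap) = isSome (U.[? c]%fmap).
  have /fsetP/(_ c) := fr_dom fr.
  by case: fndP => h1; case: fndP => h2; rewrite ?h1 ?h2 // ?(negbTE h1) ?(negbTE h2).
have old i j y : V.[? (i, j)]%fmap = Some y -> exists2 x, U.[? (i, j)]%fmap = Some x &
    [/\ x = y, kind y <> inl a & kind y <> inr b] \/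
    (kind x = inl a \/ kind x = inr b) /\ (kind y = inl a \/ kind y = inr b).
  move=> hy; have: U.[? (i, j)]%fmap by rewrite -dV hy.
  case hx: (U.[? (i, j)]%fmap) => [x|//] _; exists x => //.
  have [abU|nab] := boolP (ab a b U (i, j)).
    right; split; first by apply/(ab_kind hx).
    by apply/(ab_kind hy); rewrite (fr_ab fr).
  left; have := fr_out fr nab; rewrite hx hy => -[yx]; subst y.
  by split=> // k; case/negP: nab; apply/(ab_kind hx); [left|right].
split.
- by move=> i j y /old[x hx _]; exact: (tb_shifted tb hx).
- by move=> i j k l x y; rewrite !dV; apply: (tb_convex tb).
- move=> [i j] y hy; have [x hx [[<- _ _]|[_ ky]]] := old _ _ _ hy; first exact: (tb_range tb hx).
  by case: ky => ->.
- move=> i j k l y z hy hz ik jl.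
  have [y0 hy0 cy] := old _ _ _ hy; have [z0 hz0 cz] := old _ _ _ hz.
  have := tb_le tb hy0 hz0 ik jl; have := tb_range tb hy0; have := tb_range tb hz0.
  case: cy => [[ey ny1 ny2]|[ky0 ky]]; case: cz => [[ez nz1 nz2]|[kz0 kz]].
  + subst y0 z0; case: y ny1 ny2 {hy hy0} => y ny1 ny2; case: z nz1 nz2 {hz hz0} => z nz1 nz2 //= _ _;
      rewrite ?orbF //; do 2?[case: eqP => //= ?]; rewrite ?orbF //; try by move=> ->.
    by case: nz2 => /=; f_equal.
  + subst y0; case: y ny1 ny2 {hy hy0} => -[y py] /= ny1 ny2 _ ry.
      have ne : y <> a by move=> e; case: ny1; rewrite e.
      by case: kz => ->; case: kz0 => -> /=; rewrite ?Xb //; lia.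
    have ne : y <> b by move=> e; case: ny2; rewrite e.
    by case: kz => ->; case: kz0 => -> /=; rewrite ?Xa //; lia.
  + subst z0; case: z nz1 nz2 {hz hz0} => -[z pz] /= nz1 nz2 rz _.
      have ne : z <> a by move=> e; case: nz1; rewrite e.
      by case: ky => ->; case: ky0 => -> /=; rewrite ?Xb //; lia.
    have ne : z <> b by move=> e; case: nz2; rewrite e.
    by case: ky => ->; case: ky0 => -> /=; rewrite ?Xa //; lia.
  + move=> _ _ _; case: ky kz => ky [] kz; rewrite ky kz /= ?leqnn ?eqxx ?orbT //; exfalso.
    case: y ky hy => -[y py] //= -[->] hy; case: z kz hz => -[z pz] //= -[->] hz.
    have h1 : cells_of a b V i j = Some (inl py) by rewrite /cells_of hy /= eqxx.
    have h2 : cells_of a b V k l = Some (inr pz) by rewrite /cells_of hz /= eqxx.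
    by move: (fully_switchedP pf full h1 h2); rewrite ik jl.
- move=> i j k l y z hy hz kyz.
  have [y0 hy0 cy] := old _ _ _ hy; have [z0 hz0 cz] := old _ _ _ hz.
  case: cy => [[ey ny1 ny2]|[_ ky]].
    case: cz => [[ez _ _]|[_ [] kz]]; [|by case: ny1; rewrite kyz|by case: ny2; rewrite kyz].
    by subst y0 z0; apply: (tb_ordered tb hy0 hz0).
  clear z0 hz0 cz; case: ky => ky; have kz := kyz; rewrite ky in kz.
    case: y ky hy {kyz} => -[y py] //= -[->] hy; case: z kz hz => -[z pz] //= -[<-] hz.
    by apply: (pf_a pf); rewrite /cells_of ?hy ?hz /= eqxx.
  case: y ky hy {kyz} => -[y py] //= -[->] hy; case: z kz hz => -[z pz] //= -[<-] hz.
  by apply: (pf_b pf); rewrite /cells_of ?hy ?hz /= eqxx.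
- move=> i y hy; have [y0 hy0 [[<- _ _]|[_ ky]]] := old _ _ _ hy; first exact: (tb_diag tb hy0).
  case: ky => ky; case: y ky hy => -[y py] //= -[->] hy.
    by apply: (pf_diag_a pf (i := i)); rewrite /cells_of hy /= eqxx.
  by apply: (pf_diag_b pf (i := i)); rewrite /cells_of hy /= eqxx.
Qed.

End Stage.

(** * Shifted diagrams as order ideals *)

(** Strictness gains one unit per row; hence the last columns of the rows weakly decrease, which
    makes shifted diagrams closed towards north-west. *)
Lemma strict_part_drop lam k d : strict_partition lam -> k + d < size lam ->
  nth 0 lam (k + d) + d <= nth 0 lam k.
Proof.
case/andP=> /(sortedP 0) srt _; elim: d => [|d IHd] kd; first by rewrite !addn0.
have := srt (k + d); rewrite -addnS => /(_ kd).
by move: (IHd ltac:(lia)); rewrite /gtn /=; lia.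
Qed.

Lemma shifted_diagram_down lam i j k l : strict_partition lam ->
  shifted_diagram lam (k, l) -> 0 < i <= k -> i <= j <= l -> shifted_diagram lam (i, j).
Proof.
move=> st; rewrite /shifted_diagram /= /part => /andP[k1 k2] ik jl.
have := @strict_part_drop lam i.-1 (k - i) st.
rewrite (_ : i.-1 + (k - i) = k.-1); last by lia.
by move=> /(_ ltac:(lia)); lia.
Qed.

Lemma included_diagram mu lam : strict_partition mu ->
  (forall c, shifted_diagram mu c -> shifted_diagram lam c) -> included mu lam.
Proof.
move=> st sub i i1; case: (posnP (part mu i)) => [->//|p0].
have ism : i <= size mu.
  by rewrite leqNgt; apply/negP => h; move: p0; rewrite /part nth_default //; lia.
(* The last box of row [i] of [mu] detects the length of the row. *)
by have := sub (i, part mu i + i - 1); rewrite /shifted_diagram /=; lia.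
Qed.

Lemma diagram_included mu lam c : strict_partition mu -> included mu lam ->
  shifted_diagram mu c -> shifted_diagram lam c.
Proof.
case: c => i j st inc; rewrite /shifted_diagram /= => /andP[h1 h2].
have := inc i ltac:(lia); move=> h.
have : i <= size lam.
  by rewrite leqNgt; apply/negP => hl; move: h; rewrite [part lam i]nth_default //; lia.
by lia.
Qed.

(** A bounded order ideal is read off from its row lengths [r], counted from the diagonal, and its
    number [L] of diagonal boxes. *)
Lemma ideal_partition (G : pred box) N :
  (forall i j, G (i, j) -> [&& 0 < i, i <= j & j <= N]) ->
  (forall i j k l, G (k, l) -> 0 < i <= k -> i <= j <= l -> G (i, j)) ->
  exists2 gam, strict_partition gam & forall c, shifted_diagram gam c = G c.
Proof.
move=> bd down.
have exr i : exists k, ~~ G (i, i + k).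
  by exists N.+1; apply/negP => /bd; lia.
pose r i := ex_minn (exr i).
have rP i k : G (i, i + k) = (k < r i).
  rewrite /r; case: ex_minnP => t nt min; apply/idP/idP => [h|kt].
    rewrite ltnNge; apply/negP => tk; case/negP: nt.
    by have := bd _ _ h; move=> b; apply: (down _ _ _ _ h); lia.
  by apply/negPn/negP => /min; lia.
have exL : exists k, ~~ G (k.+1, k.+1).
  by exists N; apply/negP => /bd; lia.
pose L := ex_minn exL.
have LP i : 0 < i -> G (i, i) = (i <= L).
  case: i => // i _; rewrite /L; case: ex_minnP => t nt min; apply/idP/idP => [h|kt].
    rewrite ltnNge; apply/negP => tk; case/negP: nt.
    by apply: (down _ _ _ _ h); lia.
  by apply/negPn/negP => /min; lia.
have rpos i : 0 < i <= L -> 0 < r i.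
  by move=> iL; rewrite -rP addn0 LP; lia.
exists (mkseq (fun i => r i.+1) L); last first.
  move=> [i j]; rewrite /shifted_diagram /= /part size_mkseq.
  apply/idP/idP => [/andP[iL ij]|h].
    rewrite nth_mkseq in ij; last by lia.
    rewrite (_ : j = i + (j - i)); last by lia.
    by rewrite rP; move: ij; rewrite prednK; lia.
  have b := bd _ _ h.
  have iL : i <= L by rewrite -LP; [apply: (down _ _ _ _ h)|]; lia.
  rewrite nth_mkseq ?prednK; try lia.
  have : j - i < r i by rewrite -rP subnKC //; lia.
  by lia.
apply/andP; split.
  apply/(sortedP 0) => i; rewrite size_mkseq => iL; rewrite !nth_mkseq //; try lia.
  rewrite /= -rP.
  (* The box above the last box of a row is at offset [r i.+2] from the diagonal in its own row,
     whence the strict decrease. *)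
  have h : G (i.+2, i.+2 + (r i.+2).-1).
    by rewrite rP; have := rpos i.+2; lia.
  by have := rpos i.+2; move=> b; apply: (down _ _ _ _ h); lia.
apply/negP => /mapP[i]; rewrite mem_iota => iL.
by have := rpos i.+1; lia.
Qed.

(** * Tableau switching *)

Lemma fnd_mapf (A B : Type) (F : {fmap box -> A}) (f : A -> B) c :
  ([fmap d : domf F => f (F d)].[? c] = omap f F.[? c])%fmap.
Proof.
case: (fndP F c) => [cF|ncF] /=; last by rewrite not_fnd.
by rewrite in_fnd ffunE.
Qed.

Lemma fnd_label (S T : filling) c : ((label S T).[? c] =
  if T.[? c] is Some y then Some (inr y) else omap inl S.[? c])%fmap.
Proof.
rewrite /label fnd_cat !fnd_mapf /=.
by case: ifP => [cT|/negbT cT]; [rewrite in_fnd|rewrite (not_fnd cT)].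
Qed.

Lemma fnd_S_part (U : pair_filling) c :
  ((S_part U).[? c] = if U.[? c] is Some (inl x) then Some x else None)%fmap.
Proof.
rewrite /S_part fnd_reducef.
rewrite (fnd_mapf U (fun z => if z is inl x then Some x else None)).
by case: (U.[? c])%fmap => [[]|].
Qed.

Lemma fnd_T_part (U : pair_filling) c :
  ((T_part U).[? c] = if U.[? c] is Some (inr x) then Some x else None)%fmap.
Proof.
rewrite /T_part fnd_reducef.
rewrite (fnd_mapf U (fun z => if z is inr x then Some x else None)).
by case: (U.[? c])%fmap => [[]|].
Qed.

(** A sum over boxes rather than a cardinal over a subtype lets weights on different domains be
    compared. *)
Lemma wtE (F : filling) k :
  wt F k = \sum_(c <- domf F) (if F.[? c]%fmap is Some x then num x == k else false).
Proof.
rewrite /wt -sum1_card big_mkcond big_seq_fsetE /=; apply: eq_bigr => c _.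
by rewrite -Some_fnd inE; case: (_ == k).
Qed.

Lemma wt_S_part U k :
  wt (S_part U) k = occ (fun z => if z is inl x then num x == k else false) U.
Proof.
rewrite wtE /occ (eq_bigr (fun c => nat_of_bool
  (holds_at (fun z => if z is inl x then num x == k else false) U c))); last first.
  by move=> c _; rewrite fnd_S_part /holds_at; case: (U.[? c])%fmap => [[]|].
apply: big_fset_incl => [|c _]; rewrite -?fndSome ?fnd_S_part /holds_at; last first.
  by case: (U.[? c])%fmap => [[]|].
apply/fsubsetP => c; rewrite -!fndSome fnd_S_part.
by case: (U.[? c])%fmap.
Qed.

Lemma wt_T_part U k :
  wt (T_part U) k = occ (fun z => if z is inr x then num x == k else false) U.
Proof.
rewrite wtE /occ (eq_bigr (fun c => nat_of_bool
  (holds_at (fun z => if z is inr x then num x == k else false) U c))); last first.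
  by move=> c _; rewrite fnd_T_part /holds_at; case: (U.[? c])%fmap => [[]|].
apply: big_fset_incl => [|c _]; rewrite -?fndSome ?fnd_T_part /holds_at; last first.
  by case: (U.[? c])%fmap => [[]|].
apply/fsubsetP => c; rewrite -!fndSome fnd_T_part.
by case: (U.[? c])%fmap.
Qed.

(** * Semistandard tableaux through south-east comparisons *)

Lemma fnd_domf (F : filling) c x : (F.[? c])%fmap = Some x ->
  exists2 d : domf F, val d = c & F d = x.
Proof.
case: fndP => // cF [xE]; exists [` cF]%fset => //.
Qed.

(** The row and column conditions are chained through the corner [(i, l)], which lies in the skew
    shape because both diagrams are closed towards north-west. *)
Lemma SSYT_le F i j k l x y : SSYT F ->
  F.[? (i, j)]%fmap = Some x -> F.[? (k, l)]%fmap = Some y -> i <= k -> j <= l ->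
  letter_le x y /\ (num x = num y -> ordered (primed x) (primed y) i j k l).
Proof.
case=> [[[lam [mu [lam_st mu_st inc dom]]] [_ row col col1 row1]] _] hx hy ik jl.
have [d dE Fd] := fnd_domf hx; have [e eE Fe] := fnd_domf hy.
have xF : (i, j) \in domf F by rewrite -fndSome hx.
have yF : (k, l) \in domf F by rewrite -fndSome hy.
have: (i, l) \in domf F.
  move: xF yF; rewrite !dom !inE => /andP[x1 x2] /andP[y1 y2]; apply/andP; split.
    by apply: (shifted_diagram_down lam_st y1); move: x1; rewrite /shifted_diagram /=; lia.
  apply: contra x2 => zmu; apply: (shifted_diagram_down mu_st zmu);
    by move: x1; rewrite /shifted_diagram /=; lia.
move=> zF; set z := F [` zF]%fset.
have xz : letter_le x z by rewrite -Fd; apply: row; rewrite dE.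
have zy : letter_le z y by rewrite -Fe; apply: col; rewrite eE.
split; first by move: xz zy; rewrite /letter_le; lia.
move=> nxy; rewrite /ordered.
have nz : num z = num x by move: xz zy; rewrite /letter_le; lia.
have px : primed y -> primed x by move: xz zy; rewrite /letter_le; lia.
have ri : primed y -> i = k -> j = l.
  move=> py e0; have p := px py.
  have xy : F d = F e.
    by rewrite Fd Fe; move: nxy p py; case: x {hx Fd xz nz px} => ? ?; case: y {hy Fe zy} => ? ? /= -> -> ->.
  by have := row1 d e; rewrite dE eE /= Fd => /(_ e0) h; move: h; rewrite -Fd => /(_ xy); rewrite Fd => /(_ p) de; move: eE; rewrite -de dE => -[].
have ci : ~~ primed x -> j = l -> i = k.
  move=> npx e0; have npy : ~~ primed y by apply: contra npx.
  have xy : F d = F e.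
    rewrite Fd Fe; move: nxy npx npy; case: x {hx Fd xz nz px} => ? ?; case: y {hy Fe zy ri} => ? ? /= ->.
    by move=> /negbTE -> /negbTE ->.
  by have := col1 d e; rewrite dE eE /= => /(_ e0 xy); rewrite Fd => /(_ npx) de; move: eE; rewrite -de dE => -[].
by move: px ri ci; case: (primed x); case: (primed y) => //=; lia.
Qed.

Lemma SSYT_num F c x : SSYT F -> F.[? c]%fmap = Some x -> 0 < num x <= max_letter F.
Proof.
case=> [[_ [pos _ _ _ _]] _] h; have [d dE Fd] := fnd_domf h.
rewrite -Fd pos /=; exact: (leq_bigmax (F := fun c : domf F => num (F c))).
Qed.

Lemma SSYT_diag F i x : SSYT F -> F.[? (i, i)]%fmap = Some x -> primed x = false.
Proof.
case=> [_ diag] h; have [d dE Fd] := fnd_domf h.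
by rewrite -Fd; apply/negbTE/diag; rewrite dE.
Qed.

(** A converse to [SSYT_le], used to read tableaux off the final filling. *)
Lemma SSYT_of_le lam mu F : has_shape lam mu F ->
  (forall c x, F.[? c]%fmap = Some x -> 0 < num x) ->
  (forall i j k l x y, F.[? (i, j)]%fmap = Some x -> F.[? (k, l)]%fmap = Some y ->
    i <= k -> j <= l -> num x <= num y) ->
  (forall i j k l x y, F.[? (i, j)]%fmap = Some x -> F.[? (k, l)]%fmap = Some y ->
    num x = num y -> ordered (primed x) (primed y) i j k l) ->
  (forall i x, F.[? (i, i)]%fmap = Some x -> primed x = false) -> SSYT F.
Proof.
move=> shape pos le_num ord diag.
have fF (c : domf F) : F.[? ((val c).1, (val c).2)]%fmap = Some (F c).
  by rewrite -surjective_pairing Some_fnd.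
have mono (c d : domf F) : (val c).1 <= (val d).1 -> (val c).2 <= (val d).2 -> letter_le (F c) (F d).
  move=> h1 h2; have le := le_num _ _ _ _ _ _ (fF c) (fF d) h1 h2.
  rewrite /letter_le; case: ltngtP le => // nE _ /=.
  have [cd|ncd] := eqVneq c d; first by subst d; apply/implyP.
  have : ((val c).1 < (val d).1) || ((val c).2 < (val d).2).
    rewrite ltn_neqAle h1 andbT [X in _ || X]ltn_neqAle h2 andbT -negb_and.
    apply: contra ncd => /andP[/eqP e1 /eqP e2]; apply/eqP/val_inj.
    by rewrite [val c]surjective_pairing [val d]surjective_pairing e1 e2.
  by move: (ord _ _ _ _ _ _ (fF c) (fF d) nE); rewrite /ordered h1 h2 => /implyP h /h /andP[/implyP h' _]; apply/implyP => /h' /andP[].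
have inj (c d : domf F) : (val c).1 = (val d).1 -> (val c).2 = (val d).2 -> c = d.
  move=> e1 e2; apply: val_inj.
  by rewrite [val c]surjective_pairing [val d]surjective_pairing e1 e2.
split; last first.
  by move=> c e; apply/negbT; apply: (diag (val c).1); rewrite [X in (_, X)]e -(fF c) e.
split; first by exists lam, mu.
split=> [c|c d e h|c d e h|c d e cd np|c d e cd p].
- by apply: pos (fF c).
- by apply: mono; rewrite ?e.
- by apply: mono; rewrite ?e.
- apply: inj => //; have := ord _ _ _ _ _ _ (fF c) (fF d); have := ord _ _ _ _ _ _ (fF d) (fF c).
  by rewrite cd in np *; rewrite (negbTE np) e => /(_ erefl) h1 /(_ erefl); move: h1; rewrite /ordered; lia.
- apply: inj => //; have := ord _ _ _ _ _ _ (fF c) (fF d); have := ord _ _ _ _ _ _ (fF d) (fF c).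
  by rewrite cd in p *; rewrite p e => /(_ erefl) h1 /(_ erefl); move: h1; rewrite /ordered; lia.
Qed.

(* The pairs of letters exchanged before [(a, b)] in the switching order. *)
Definition stage (a b i j : nat) : bool := (a < i) || (i == a) && (j < b).

(** * The sequence of exchanges *)

Lemma tableau_switching_row m n a k U : 0 < a <= m -> k <= n -> tableau m n (stage a 1) U ->
  let V := foldl (fun U ij => process ij.1 ij.2 U) U [seq (a, j) | j <- iota 1 k] in
  [/\ tableau m n (stage a k.+1) V, domf V = domf U
    & forall P, unprimed_pred P -> occ P V = occ P U].
Proof.
move=> am; elim: k => [|k IHk] kn tb; first by split.
rewrite -[k.+1]addn1 iotaD map_cat foldl_cat /=.
have [] := IHk (ltnW kn) tb; set V := foldl _ _ _ => tbV domV occV.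
have kr : 0 < 1 + k <= n by lia.
have Xb i : 0 < i <= m -> stage a k.+1 i (1 + k) = (a < i) by rewrite /stage; lia.
have Xa j : 0 < j <= n -> stage a k.+1 a j = (j < 1 + k) by rewrite /stage; lia.
have [_ fr _] := process_correct (tableau_perforated am kr Xb Xa tbV).
split=> [||P hP]; [|by rewrite (fr_dom fr) domV|by rewrite (fr_occ fr) // occV].
apply: tableau_ext (tableau_process am kr Xb Xa tbV) => i j _ _.
by rewrite /stage; lia.
Qed.

Lemma tableau_switching m n t U : t <= m -> tableau m n (stage t 1) U ->
  let V := foldl (fun U ij => process ij.1 ij.2 U) U (switching_order t n) in
  [/\ tableau m n (stage 0 1) V, domf V = domf U
    & forall P, unprimed_pred P -> occ P V = occ P U].
Proof.
elim: t U => [|t IHt] U tm tb; first by split.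
rewrite /switching_order -[t.+1]addn1 iotaD cats1 rev_rcons allpairs_cons foldl_cat.
have := tableau_switching_row (k := n) (a := 1 + t) tm (leqnn n) tb.
case; set V := foldl _ _ _ => tbV domV occV.
(* Passing [1 + t] beyond all letters up to [n] gives the same order, on letters in range, as being
   about to start with [t]. *)
have tbV' : tableau m n (stage t 1) V.
  by apply: tableau_ext tbV => i j _ jn; rewrite /stage; lia.
have [tbW domW occW] := IHt V (ltnW tm) tbV'.
split=> [||P hP] //; first by rewrite domW.
by rewrite occW // occV.
Qed.

(** * The initial and the final filling *)

Section Switching.
Variables (lam mu nu : seq nat) (S T : filling).
Hypotheses (hS : SSYT S) (hT : SSYT T) (shT : has_shape lam mu T) (shS : has_shape mu nu S).

Lemma labelP c x : ((label S T).[? c])%fmap = Some x ->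
  match x with
  | inl y => S.[? c]%fmap = Some y /\ shifted_diagram mu c
  | inr y => T.[? c]%fmap = Some y /\ ~~ shifted_diagram mu c
  end.
Proof.
have [_ _ _ domT] := shT; have [_ _ _ domS] := shS.
rewrite fnd_label; case hTc: (T.[? c])%fmap => [y|] /=.
  move=> [<-]; split=> //.
  have : c \in domf T by rewrite -fndSome hTc.
  by rewrite domT inE => /andP[].
case hSc: (S.[? c])%fmap => [y|//] /= [<-]; split=> //.
have : c \in domf S by rewrite -fndSome hSc.
by rewrite domS inE => /andP[].
Qed.

Lemma mem_label c : (c \in domf (label S T)) = shifted_diagram lam c && ~~ shifted_diagram nu c.
Proof.
have [_ mu_st inc1 domT] := shT; have [_ nu_st inc2 domS] := shS.
rewrite /label mem_catf /= domS domT !inE.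
have := @diagram_included nu mu c nu_st inc2; have := @diagram_included mu lam c mu_st inc1.
by case: (shifted_diagram lam c); case: (shifted_diagram mu c); case: (shifted_diagram nu c) => //= h1 h2;
  try (by move: (h1 erefl)); try (by move: (h2 erefl)).
Qed.

Lemma tableau_label :
  tableau (max_letter S) (max_letter T) (stage (max_letter S) 1) (label S T).
Proof.
have [lam_st mu_st inc1 domT] := shT; have [_ nu_st inc2 domS] := shS.
apply: (@tableau_ext _ _ (fun _ _ => false)).
  by move=> i j im jn; rewrite /stage; lia.
split.
- move=> i j x h; have : (i, j) \in domf (label S T) by rewrite -fndSome h.
  by rewrite mem_label /shifted_diagram /=; lia.
- move=> i j k l x y; rewrite !fndSome !mem_label => /andP[x1 x2] /andP[y1 y2] xk yl xy.
  apply/andP; split.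
    by apply: (shifted_diagram_down lam_st y1); move: x1; rewrite /shifted_diagram /=; lia.
  apply: contra x2 => h; apply: (shifted_diagram_down nu_st h);
    by move: x1; rewrite /shifted_diagram /=; lia.
- by move=> c [x|x] /labelP[h _] /=; [exact: (SSYT_num hS h)|exact: (SSYT_num hT h)].
- move=> i j k l [x|x] [y|y] /labelP[hx mx] /labelP[hy my] ik jl //=.
  + have [le _] := SSYT_le hS hx hy ik jl; by move: le; rewrite /letter_le; lia.
  (* A T-box north-west of an S-box would lie in the diagram of [mu], which is closed towards
     north-west. *)
  + case/negP: mx; apply: (shifted_diagram_down mu_st my) => //.
      have : (i, j) \in domf T by rewrite -fndSome hx.
      by rewrite domT inE /shifted_diagram /=; lia.
    have : (i, j) \in domf T by rewrite -fndSome hx.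
    by rewrite domT inE /shifted_diagram /=; lia.
  + have [le _] := SSYT_le hT hx hy ik jl; by move: le; rewrite /letter_le; lia.
- move=> i j k l [x|x] [y|y] /labelP[hx mx] /labelP[hy my] //= [] e.
  + rewrite /ordered; have [ik|] := leqP i k; have [jl|] := leqP j l => //.
    by have [_ /(_ e)] := SSYT_le hS hx hy ik jl; rewrite /ordered ik jl.
  + rewrite /ordered; have [ik|] := leqP i k; have [jl|] := leqP j l => //.
    by have [_ /(_ e)] := SSYT_le hT hx hy ik jl; rewrite /ordered ik jl.
- by move=> i [x|x] /labelP[h _] /=; [exact: (SSYT_diag hS h)|exact: (SSYT_diag hT h)].
Qed.

Lemma S_part_label : S_part (label S T) = S.
Proof.
apply/fmapP => c; rewrite fnd_S_part.
case h: ((label S T).[? c])%fmap => [[x|x]|].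
- by have [-> _] := labelP h.
- have [hc mc] := labelP h; rewrite not_fnd //.
  by have [_ _ _ ->] := shS; rewrite inE negb_and mc.
- by move: h; rewrite fnd_label; case: (T.[? c])%fmap => //; case: (S.[? c])%fmap.
Qed.

Lemma T_part_label : T_part (label S T) = T.
Proof.
apply/fmapP => c; rewrite fnd_T_part.
case h: ((label S T).[? c])%fmap => [[x|x]|].
- have [hc mc] := labelP h; rewrite not_fnd //.
  by have [_ _ _ ->] := shT; rewrite inE negb_and mc orbT.
- by have [-> _] := labelP h.
- by move: h; rewrite fnd_label; case: (T.[? c])%fmap.
Qed.

(** Under [stage 0 1] every letter of T precedes every letter of S, so no S-box is north-west of a
    T-box; the T-boxes with the diagram of [nu] form the ideal whose partition is [gam]. *)
Lemma switched_shapes m n U : tableau m n (stage 0 1) U -> domf U = domf (label S T) ->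
  exists gam, has_shape lam gam (S_part U) /\ has_shape gam nu (T_part U).
Proof.
move=> tb domU; have [lam_st mu_st inc1 _] := shT; have [_ nu_st inc2 _] := shS.
have nu_lam c : shifted_diagram nu c -> shifted_diagram lam c.
  by move=> /(diagram_included nu_st inc2) /(diagram_included mu_st inc1).
have dU c : isSome (U.[? c])%fmap = shifted_diagram lam c && ~~ shifted_diagram nu c.
  by rewrite -mem_label -domU -fndSome.
pose isT c := if U.[? c]%fmap is Some (inr _) then true else false.
have isT_lam c : isT c -> shifted_diagram lam c && ~~ shifted_diagram nu c.
  by rewrite -dU /isT; case: (U.[? c])%fmap.
pose G : pred box := fun c => shifted_diagram nu c || isT c.
have G_lam c : G c -> shifted_diagram lam c.
  by case/orP=> [/nu_lam|/isT_lam /andP[]].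
have pos i j : shifted_diagram lam (i, j) -> 0 < i <= j by rewrite /shifted_diagram /=; lia.
(* The first row of [lam] bounds all columns, since [(1, j)] lies above any box of column [j]. *)
have [|i j k l|gam gam_st gamG] := @ideal_partition G (part lam 1).
- move=> i j /G_lam h; have ij := pos _ _ h.
  have : shifted_diagram lam (1, j) by apply: (shifted_diagram_down lam_st h); lia.
  by move: ij; rewrite /shifted_diagram /=; lia.
- move=> Gkl ik jl; have lam_kl := G_lam _ Gkl.
  have lam_ij := shifted_diagram_down lam_st lam_kl ik jl.
  case/orP: Gkl => [nu_kl|T_kl].
    by apply/orP; left; apply: (shifted_diagram_down nu_st nu_kl).
  rewrite /G; have [//|nnu] /= := boolP (shifted_diagram nu (i, j)).
  have := dU (i, j); rewrite lam_ij nnu /isT.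
  case hx: (U.[? (i, j)])%fmap => [[x|//]|//] _.
  move: T_kl; rewrite /isT; case hy: (U.[? (k, l)])%fmap => [[//|y]|//] _.
  have /andP[i0 ik'] := ik; have /andP[_ jl'] := jl.
  have := tb_le tb hx hy ik' jl'; have := tb_range tb hx.
  by rewrite /= /stage => /andP[->].
exists gam; split; split=> //.
- by apply: included_diagram => // c; rewrite gamG; apply: G_lam.
- move=> c; transitivity (shifted_diagram lam c && ~~ shifted_diagram gam c) => //.
  rewrite gamG /G negb_or -fndSome fnd_S_part andbA.
  by rewrite -dU /isT; case: (U.[? c])%fmap => [[]|].
- by apply: included_diagram => // c nu_c; rewrite gamG /G nu_c.
- move=> c; transitivity (shifted_diagram gam c && ~~ shifted_diagram nu c) => //.
  rewrite gamG /G -fndSome fnd_T_part.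
  have := isT_lam c; rewrite /isT; case: (U.[? c])%fmap => [[x|x]|] //=;
    case: (shifted_diagram nu c); rewrite ?andbF ?andbT //=.
  by move=> /(_ erefl).
Qed.

Lemma SSYT_S_part lam' mu' m n X U : tableau m n X U -> has_shape lam' mu' (S_part U) ->
  SSYT (S_part U).
Proof.
have fS c x : (S_part U).[? c]%fmap = Some x -> U.[? c]%fmap = Some (inl x).
  by rewrite fnd_S_part; case: (U.[? c])%fmap => [[y [->]|]|].
move=> tb sh; apply: (SSYT_of_le sh).
- by move=> c x /fS /(tb_range tb) /= /andP[].
- by move=> i j k l x y /fS hx /fS hy ik jl; apply: (tb_le tb hx hy).
- by move=> i j k l x y /fS hx /fS hy e; apply: (tb_ordered tb hx hy); rewrite /= e.
- by move=> i x /fS /(tb_diag tb).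
Qed.

Lemma SSYT_T_part lam' mu' m n X U : tableau m n X U -> has_shape lam' mu' (T_part U) ->
  SSYT (T_part U).
Proof.
have fT c x : (T_part U).[? c]%fmap = Some x -> U.[? c]%fmap = Some (inr x).
  by rewrite fnd_T_part; case: (U.[? c])%fmap => [[|y [->]]|].
move=> tb sh; apply: (SSYT_of_le sh).
- by move=> c x /fT /(tb_range tb) /= /andP[].
- by move=> i j k l x y /fT hx /fT hy ik jl; apply: (tb_le tb hx hy).
- by move=> i j k l x y /fT hx /fT hy e; apply: (tb_ordered tb hx hy); rewrite /= e.
- by move=> i x /fT /(tb_diag tb).
Qed.

Lemma domf_parts U : domf (S_part U + T_part U)%fset = domf U.
Proof.
apply/fsetP => c; rewrite mem_catf -!fndSome fnd_S_part fnd_T_part.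
by case: (U.[? c])%fmap => [[]|].
Qed.

End Switching.

Theorem theorem6p4 (lam mu nu : seq nat) (S T : filling)
    (hS : SSYT S) (hT : SSYT T) (hST : extends lam mu nu T S) :
  let: (T', S') := modified_switching S T in
  [/\ domf (S' + T')%fset = domf (S + T)%fset,
      forall k, wt S' k = wt S k & forall k, wt T' k = wt T k] /\
  [/\ exists gam : seq nat, extends lam gam nu S' T', SSYT T' & SSYT S'].
Proof.
case: hST => shT shS; rewrite /modified_switching.
have [] := tableau_switching (leqnn _) (tableau_label hS hT shT shS).
set U := foldl _ _ _ => tb domU occU.
have [gam [sh1 sh2]] := switched_shapes shT shS tb domU.
split; split.
- by rewrite domf_parts domU -(domf_parts (label S T)) (S_part_label shT shS) (T_part_label shT shS).
(* Weights are counts [occ] of predicates blind to primes, hence unchanged from the initial labelled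
   filling. *)
- by move=> k; rewrite wt_S_part occU // -wt_S_part (S_part_label shT shS).
- by move=> k; rewrite wt_T_part occU // -wt_T_part (T_part_label shT shS).
- by exists gam.
- exact: SSYT_T_part tb sh2.
- exact: SSYT_S_part tb sh1.
Qed.
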